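(* Let $X$ be a metric space and let $U:\mathcal P(\Sigma^{\mathbb N})\to X$ be continuous with respect to the weak topology. Let $C\subseteq X$ be a subset of $X$. Fix a continuous function $\varphi:\Sigma^{\mathbb N}\to\mathbb R$. (1) We have $$\lim_{r\searrow 0}\underline P^U_{B(C,r)}(\varphi)=\lim_{r\searrow 0}\overline P^U_{B(C,r)}(\varphi)=\sup_{\mu\in\mathcal P_S(\Sigma^{\mathbb N}),\ U\mu\in\overline C}\Big(h(\mu)+\int\varphi\,d\mu\Big).$$ (2) We have $$\lim_{r\searrow 0}-\log\sigma_{\mathrm{rad}}\big(\zeta^{\mathrm{dyn},U}_{B(C,r)}(\varphi;\cdot)\big)=\sup_{\mu\in\mathcal P_S(\Sigma^{\mathbb N}),\ U\mu\in\overline C}\Big(h(\mu)+\int\varphi\,d\mu\Big).$$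
   Context: Fix a positive integer $N$; $\Sigma^{\mathbb N}=\{1,\dots,N\}^{\mathbb N}$ is the space of infinite strings (product topology), $\Sigma^n=\{1,\dots,N\}^n$ the strings of length $n$; $|\mathbf i|$ is the length of a finite string $\mathbf i$ and $[\mathbf i]=\{\mathbf j\in\Sigma^{\mathbb N}: \mathbf j \text{ begins with } \mathbf i\}$ its cylinder. $S(i_1i_2\dots)=i_2i_3\dots$ is the shift. $\mathcal P(\Sigma^{\mathbb N})$ denotes the Borel probability measures on $\Sigma^{\mathbb N}$ and $\mathcal P_S(\Sigma^{\mathbb N})$ the shift-invariant ones, both with the weak topology; $h(\mu)$ is the measure-theoretic entropy of $\mu\in\mathcal P_S(\Sigma^{\mathbb N})$ with respect to $S$. For $n\ge1$ let $L_n:\Sigma^{\mathbb N}\to\mathcal P(\Sigma^{\mathbb N})$, $L_n\mathbf i=\frac1n\sum_{k=0}^{n-1}\delta_{S^k\mathbf i}$, and $UL_n[\mathbf i]=\{U(L_n\mathbf u):\mathbf u\in[\mathbf i]\}$. For $C\subseteq X$ and continuous $\varphi:\Sigma^{\mathbb N}\to\mathbb R$ put $$Z_n(C,\varphi)=\sum_{|\mathbf i|=n,\ UL_n[\mathbf i]\subseteq C}\ \sup_{\mathbf u\in[\mathbf i]}\exp\sum_{k=0}^{n-1}\varphi(S^k\mathbf u).$$ The lower and upper multifractal pressures are $\underline P^U_C(\varphi)=\liminf_n\frac1n\log Z_n(C,\varphi)$ and $\overline P^U_C(\varphi)=\limsup_n\frac1n\log Z_n(C,\varphi)$. The dynamical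 multifractal zeta-function is the power series $\zeta_C^{\mathrm{dyn},U}(\varphi;z)=\sum_{n\ge1}\frac{z^n}{n}Z_n(C,\varphi)$, and $\sigma_{\mathrm{rad}}(f)\in[0,\infty]$ denotes the radius of convergence of a power series $f$. Conventions: empty sums are $0$, $\log0=-\infty$, $\log\infty=\infty$, $\sup\varnothing=-\infty$. $\overline C$ is the closure of $C$ and $B(C,r)=\{x\in X:\operatorname{dist}(x,C)<r\}$ is the open $r$-neighbourhood of $C$. *)

(* Defs.v *)
From HB Require Import structures.
From mathcomp Require Import all_boot all_order all_algebra.
From mathcomp Require Import complex.
From mathcomp Require Import all_classical all_reals all_analysis.
Import Order.TTheory GRing.Theory Num.Theory.
Import numFieldNormedType.Exports.

Set Implicit Arguments.
Unset Strict Implicit.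
Unset Printing Implicit Defensive.

Local Open Scope classical_set_scope.
Local Open Scope ring_scope.

(* Infinite strings over an alphabet of N.+1 letters: the successor makes the
   alphabet nonempty, hence the space pointed, as measurable types must be. *)
Definition strings (N : nat) : Type :=
  prod_topology (fun _ : nat => discrete_topology 'I_N.+1).

HB.instance Definition _ N := Topological.on (strings N).
HB.instance Definition _ N := isPointed.Build (strings N) (fun=> ord0).

HB.instance Definition _ N :=
  Measurable.copy (strings N) (g_sigma_algebraType (@open (strings N))).

Section strings.
Context {N : nat}.

Definition shift (u : strings N) : strings N := fun n => u n.+1.

Definition cylinder n (i : n.-tuple 'I_N.+1) : set (strings N) :=
  [set u | forall k : 'I_n, u k = tnth i k].

End strings.

(* Weak topology: the coarsest one making mu |-> \int f dmu continuous for every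
   continuous real f (such f are bounded, since strings N is compact). *)
Section weak_topology.
Variables (R : realType) (N : nat).

Definition integrals (mu : probability (strings N) R) :
    prod_topology (fun _ : {f : strings N -> R | continuous f} => R) :=
  fun f => \int[mu]_u sval f u.

Definition weak_probability : Type := initial_topology integrals.

HB.instance Definition _ := Topological.on weak_probability.

End weak_topology.

Section empirical.
Context {R : realType} {N : nat}.

(* mnormalize divides by the total mass n of the sum; its second argument is a
   default used only for the null measure, i.e. for n = 0. *)
Definition empirical (n : nat) (u : strings N) : probability (strings N) R :=
  mnormalize (msum (fun k => dirac (iter k shift u)) n) (dirac u).

Lemma empiricalE (n : nat) (u : strings N) (A : set (strings N)) : (0 < n)%N ->
  empirical n u A = ((n%:R^-1)%:E * \sum_(k < n) \d_(iter k shift u) A)%E.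
Proof.
move=> n0; rewrite /= /mnormalize /= /msum.
have -> : (\sum_(k < n) \d_(iter k shift u) [set: strings N] = n%:R%:E :> \bar R)%E.
  under eq_bigr do rewrite diracT.
  by rewrite sumEFin sumr_const card_ord.
by rewrite eqe pnatr_eq0 gtn_eqF//= muleC.
Qed.

End empirical.

Section entropy.
Context {R : realType} {N : nat}.
Implicit Types mu : probability (strings N) R.

Definition invariant mu :=
  forall A, measurable A -> mu (shift @^-1` A) = mu A.

Definition finite_partition k (P : 'I_k -> set (strings N)) :=
  [/\ forall a, measurable (P a), trivIset setT P & \bigcup_a P a = setT].

(* Cell of the join of the shift^-j P, j < n, with itinerary w *)
Definition join_cell k (P : 'I_k -> set (strings N)) n (w : n.-tuple 'I_k) :
    set (strings N) :=
  [set u | forall j : 'I_n, P (tnth w j) (iter j shift u)].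

Definition join_entropy mu k (P : 'I_k -> set (strings N)) (n : nat) : R :=
  - \sum_(w : n.-tuple 'I_k)
      (let p := fine (mu (join_cell P w)) in p * ln p).

Definition partition_entropy mu k (P : 'I_k -> set (strings N)) : R :=
  limn (fun n => n%:R^-1 * join_entropy mu P n).

Definition entropy mu : \bar R :=
  ereal_sup [set e | exists k (P : 'I_k -> set (strings N)),
    finite_partition P /\ e = (partition_entropy mu P)%:E].

End entropy.

Definition power_series {K : numFieldType} (a : nat -> K) (z : K) : nat -> K :=
  series (fun n => a n * z ^+ n).

Definition radius_of_convergence {R : realType} (a : nat -> R[i]) : \bar R :=
  ereal_sup [set (complex.Re `|z|)%:E | z in
    [set z : R[i] | cvgn (power_series a z)]].

(* dist(x, C) < r, where dist(x, set0) = +oo *)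
Definition neighborhood {R : realType} {X : metricType R} (C : set X) (r : R) :
    set X :=
  [set x | (ereal_inf [set (mdist x y)%:E | y in C] < r%:E)%E].

Section multifractal.
Context {R : realType} {N : nat} {X : metricType R}.
Variables (U : weak_probability R N -> X) (C : set X) (phi : strings N -> R).

Definition birkhoff_sum (n : nat) (u : strings N) : R :=
  \sum_(k < n) phi (iter k shift u).

Definition partition_function (n : nat) : \bar R :=
  (\sum_(i : n.-tuple 'I_N.+1 |
         `[< [set U (empirical n u) | u in cylinder i] `<=` C >])
    ereal_sup [set (expR (birkhoff_sum n u))%:E | u in cylinder i])%E.

Definition log_growth (n : nat) : \bar R :=
  ((n%:R^-1)%:E * lne (partition_function n))%E.

Definition lower_pressure : \bar R := limn_einf log_growth.

Definition upper_pressure : \bar R := limn_esup log_growth.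

(* Coefficients of \sum_(n >= 1) z^n / n * Z_n. The Z_n are finite since the
   cylinders are compact and nonempty, so that fine loses nothing. *)
Definition zeta_coef (n : nat) : R[i] :=
  if n is 0 then 0 else ((fine (partition_function n) / n%:R)%:C)%C.

Definition zeta_radius : \bar R := radius_of_convergence zeta_coef.

(* The convention sup set0 = -oo is that of ereal_sup. *)
Definition variational_sup : \bar R :=
  ereal_sup [set (entropy mu + \int[mu]_u (phi u)%:E)%E | mu in
    [set mu : probability (strings N) R |
      invariant mu /\ closure C (U mu)]].

End multifractal.

(* Main.v *)
(* Lower bound. Let mu be invariant with U mu in the closure of C. Independent
   words of a large length m with law mu produce about exp(K H_m(mu)) concatenations
   of K words whose block frequencies are close to mu, by the law of large numbers,
   and the invariance of mu makes their empirical measures weakly close to mu,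
   ergodic or not. As h(mu) <= H_m(mu) / m, by Kolmogorov-Sinai, this bounds the
   partition functions from below.

   Upper bound. Let q be the law of the m-words under mu, made positive. Every
   word i of length n with empirical measure close to mu satisfies
   \sum_k ln q(i_k ... i_(k+m-1)) >= - n (H_m(mu) + e), a condition on the integral
   of one continuous function; the exponential of 1/m times the left-hand side,
   summed over all i, stays bounded, since it is at most the mean over the m offsets
   of products of q over disjoint blocks. So near mu the partition function grows at
   rate at most H_m(mu) / m + \int phi + e. Measures that are not invariant, or whose
   image is far from C, have neighbourhoods that empirical measures eventually
   avoid. Compactness of the space of probabilities concludes. *)
Require Import Defs.
From HB Require Import structures.
From mathcomp Require Import all_boot all_order all_algebra.
From mathcomp Require Import complex.
From mathcomp Require Import ring lra zify.
From mathcomp Require Import all_classical all_reals all_analysis.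
From mathcomp Require Import measurable_realfun.
(* Again, for shift to denote that of Defs. *)
Import Defs.
Import Order.TTheory GRing.Theory Num.Theory.
Import numFieldNormedType.Exports.

Set Implicit Arguments.
Unset Strict Implicit.
Unset Printing Implicit Defensive.

Local Open Scope classical_set_scope.
Local Open Scope ring_scope.

(** * Cylinder topology *)

(** Entropy is a supremum over all finite measurable partitions, and the two bounds meet it from
    opposite sides. The upper bound has to exhibit one partition, that by first letters, whose
    entropy is the limit of H_m / m. The lower bound has to control every partition by H_m / m for
    every m, because m is fixed only after the weak neighbourhood of mu. The obstacle there is that
    a label may depend on infinitely many letters: it is guessed from finitely many, with small
    error in measure, and Gibbs' inequality bounds what wrong guesses cost. The room given by r > 0
    serves both bounds: empirical measures near mu have images near U mu, which may lie in the
    closure of C without lying in C; and a measure whose image is outside that closure is excluded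
    only once r is small, depending on the measure, until compactness provides one r for all. Words
    are indexed by tuples, but their weights are functions of plain sequences, so that cutting and
    concatenating needs no casts. *)

Section strings_topology.
Context {N : nat}.
Implicit Types u v : strings N.

Definition agree (q : nat) u v := forall k, (k < q)%N -> u k = v k.

Definition pref (q : nat) u : q.-tuple 'I_N.+1 := [tuple u i | i < q].

(** The chosen point of a cylinder: values there stand, up to a modulus of continuity, for values on
    the whole cylinder. *)
Definition pad (s : seq 'I_N.+1) : strings N := fun k => nth ord0 s k.

Lemma agree_trans q u v w : agree q u v -> agree q v w -> agree q u w.
Proof. by move=> uv vw k kq; rewrite uv// vw. Qed.

Lemma agree_sym q u v : agree q u v -> agree q v u.
Proof. by move=> uv k kq; rewrite uv. Qed.

Lemma agree_le p q u v : (p <= q)%N -> agree q u v -> agree p u v.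
Proof. by move=> pq uv k kp; apply: uv; exact: leq_trans pq. Qed.

Lemma iter_shiftE j k u : iter j shift u k = u (k + j)%N.
Proof. by elim: j k => [|j IH] k; rewrite ?addn0//= /shift IH addSnnS. Qed.

Lemma agree_iter_shift q j u v : agree (q + j) u v ->
  agree q (iter j shift u) (iter j shift v).
Proof. by move=> uv k kq; rewrite !iter_shiftE; apply: uv; rewrite ltn_add2r. Qed.

Lemma cylinderP n (i : n.-tuple 'I_N.+1) u :
  cylinder i u <-> pref n u = i.
Proof.
split=> [iu|<- k]; last by rewrite tnth_mktuple.
by apply: eq_from_tnth => k; rewrite tnth_mktuple iu.
Qed.

Lemma pref_agree n u v : pref n u = pref n v <-> agree n u v.
Proof.
split=> [uv k kn|uv].
  by have := congr1 (fun t => tnth t (Ordinal kn)) uv; rewrite !tnth_mktuple.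
by apply: eq_from_tnth => k; rewrite !tnth_mktuple uv.
Qed.

Lemma pad_pref n u : agree n (pad (pref n u)) u.
Proof.
by move=> k kn; rewrite /pad -(tnth_nth _ _ (Ordinal kn)) tnth_mktuple.
Qed.

Lemma pref_pad n (i : n.-tuple 'I_N.+1) : pref n (pad i) = i.
Proof. by apply: eq_from_tnth => k; rewrite tnth_mktuple /pad -tnth_nth. Qed.

Lemma cylinder_pad n (i : n.-tuple 'I_N.+1) : cylinder i (pad i).
Proof. by apply/cylinderP; rewrite pref_pad. Qed.

Lemma nbhs_agree q u : nbhs u [set v | agree q u v].
Proof.
elim: q => [|q IH]; first by apply: filterS filterT => v _ k; rewrite ltn0.
have : nbhs u [set v : strings N | v q = u q].
  have := @proj_continuous nat (fun=> discrete_topology 'I_N.+1) q u.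
  move=> /(_ [set a | a = u q]); apply.
  by rewrite nbhs_principalE; apply/principal_filterP.
move: IH; apply: filterS2 => v uv vq k.
by rewrite ltnS leq_eqVlt => /predU1P[->//|/uv].
Qed.

End strings_topology.
Section continuity.
Context {N : nat}.
Implicit Types u v : strings N.

Lemma agree_cvg u (F : set_system (strings N)) : Filter F ->
  (forall q, \forall v \near F, agree q u v) -> F --> u.
Proof.
move=> FF Fu; apply/cvg_sup => k; apply/cvg_image => //.
  by rewrite predeqE => a; split=> // _; exists (fun=> a).
move=> A /=; rewrite nbhs_principalE => /principal_filterP Au.
exists ((fun w : strings N => w k) @^-1` A); last first.
  rewrite image_preimage//.
  by rewrite predeqE => a; split=> // _; exists (fun=> a).
apply: filterS (Fu k.+1) => v /(_ k (ltnSn k)) uv /=.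
by rewrite -uv.
Qed.

Definition agree_filter u : set_system (strings N) :=
  filter_from [set: nat] (fun q => [set v | agree q u v]).

Lemma agree_filter_filter u : Filter (agree_filter u).
Proof.
apply: filter_from_filter; first by exists 0%N.
move=> p q _ _; exists (maxn p q) => // v uv.
by split; apply: agree_le uv; rewrite (leq_maxl,leq_maxr).
Qed.

(** The sets of strings agreeing with u up to some q generate a filter that converges to u by
    [agree_cvg], hence contains every neighbourhood of u. *)
Lemma nbhs_strings u (A : set (strings N)) :
  nbhs u A <-> exists q, forall v, agree q u v -> A v.
Proof.
split=> [uA|[q qA]]; last exact: filterS qA (nbhs_agree q u).
have FF := agree_filter_filter u.
have : agree_filter u --> u by apply: agree_cvg => q; exists q.
by move=> /(_ _ uA)[q _ qA]; exists q.
Qed.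

Lemma shift_continuous : continuous (@shift N).
Proof.
move=> u; apply: (@agree_cvg (shift u) (shift @ nbhs u)) => q.
apply: filterS (nbhs_agree q.+1 u) => v uv k kq.
exact: uv.
Qed.

Lemma compact_strings : compact [set: strings N].
Proof.
have -> : [set: strings N] =
    [set f : strings N | forall i : nat, [set: discrete_topology 'I_N.+1] (f i)].
  by rewrite predeqE.
apply: (@tychonoff nat (fun=> discrete_topology 'I_N.+1) (fun=> setT)) => _.
apply: (@finite_compact (discrete_topology 'I_N.+1)).
exact: (@finite_finset 'I_N.+1).
Qed.

(** Compactness in the form used below: q is both the length of agreement and the stage of P, and by
    monotonicity in q the largest stage of a finite subcover serves everywhere. *)
Lemma cover_strings (P : nat -> strings N -> Prop) :
  (forall p q u, (p <= q)%N -> P p u -> P q u) ->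
  (forall u, exists q, forall v, agree q u v -> P q v) ->
  exists q, forall u, P q u.
Proof.
move=> Pmono Ploc.
have /compact_near_coveringP/(_ nat \oo P _) := compact_strings.
case=> [u _|q _ /(_ q (leqnn q)) qP]; last by exists q => u; exact: qP.
have [q qP] := Ploc u.
exists ([set v | agree q u v], [set p | (q <= p)%N]).
  by split; [exact: nbhs_agree|exists q].
by move=> [v p] [/= uv qp]; apply: Pmono qp _; exact: qP.
Qed.

Context {R : realType}.

Definition modulus (f : strings N -> R) q (e : R) :=
  forall u v, agree q u v -> `|f u - f v| <= e.

Lemma uniform_modulus (f : strings N -> R) (e : R) : continuous f -> 0 < e ->
  exists q, modulus f q e.
Proof.
move=> fc e0.
have [|u|q qP] := @cover_strings
    (fun q u => forall v, agree q u v -> `|f u - f v| <= e); last by exists q.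
  by move=> p q u pq up v /(agree_le pq); exact: up.
have e20 : 0 < e / 2 by rewrite divr_gt0.
have /nbhs_strings[q qP] : nbhs u [set v | `|f u - f v| < e / 2].
  by move/cvgrPdist_lt : (fc u) => /(_ _ e20).
exists q => v uv w vw.
rewrite (_ : f v - f w = (f u - f w) - (f u - f v)); last by ring.
rewrite (le_trans (ler_normB _ _))// [leRHS](splitr e) lerD// ltW//; apply: qP => //.
exact: agree_trans vw.
Qed.

Lemma continuous_bounded (f : strings N -> R) : continuous f ->
  exists2 M, 0 <= M & forall u, `|f u| <= M.
Proof.
move=> /uniform_modulus/(_ (@ltr01 R))[q fq].
exists (1 + \sum_(i : q.-tuple 'I_N.+1) `|f (pad i)|).
  by rewrite addr_ge0// sumr_ge0.
move=> u; have := fq _ _ (agree_sym (@pad_pref N q u)).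
rewrite (bigD1 (pref q u))//= => H.
have H2 : 0 <= \sum_(i | i != pref q u) `|f (pad i)| by rewrite sumr_ge0.
have := ler_normD (f u - f (pad (pref q u))) (f (pad (pref q u))).
rewrite subrK; lra.
Qed.

Lemma modulus_continuous (f : strings N -> R) :
  (forall e, 0 < e -> exists q, modulus f q e) -> continuous f.
Proof.
move=> fm u; apply: (proj2 (@cvgrPdist_le R R^o _ (nbhs u) _ f (f u))) => e /fm[q fq].
by apply: (proj2 (nbhs_strings u _)); exists q => v; exact: fq.
Qed.

End continuity.

(** * Laws of finite-valued maps *)

Section law.
Context {d : measure_display} {T : measurableType d} {R : realType}.
Variable mu : probability T R.

Definition law {V : Type} (Z : T -> V) (t : V) : R := fine (mu (Z @^-1` [set t])).

(** Measurability of the fibres alone: for a finite target it makes every preimage measurable,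
    without a sigma-algebra on the target. *)
Definition discrete_rv {V : Type} (Z : T -> V) :=
  forall t, measurable (Z @^-1` [set t]).

Lemma law_ge0 (V : Type) (Z : T -> V) t : 0 <= law Z t.
Proof. by rewrite fine_ge0. Qed.

Lemma law_le1 (V : Type) (Z : T -> V) t : discrete_rv Z -> law Z t <= 1.
Proof.
move=> mZ; rewrite -lee_fin fineK ?probability_le1//.
exact: fin_num_measure.
Qed.

Lemma fine_measure_bigsetU (V : choiceType) (Z : T -> V) (s : seq V) (P : pred V) :
  discrete_rv Z -> uniq s ->
  measurable (\big[setU/set0]_(t <- s | P t) Z @^-1` [set t]) /\
  fine (mu (\big[setU/set0]_(t <- s | P t) Z @^-1` [set t])) =
  \sum_(t <- s | P t) law Z t.
Proof.
move=> mZ; elim: s => [_|t s IH /= /andP[ts /IH[mU IHs]]].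
  by rewrite !big_nil measure0.
rewrite !big_cons; case: ifP => Pt //; split; first exact: measurableU.
rewrite measureU//.
- by rewrite fineD ?IHs//; exact: fin_num_measure.
- rewrite -subset0 => x [/= Zx].
  rewrite -bigcup_seq_cond => -[v /= /andP[vs _]] Zv.
  by move: ts; rewrite -Zx Zv vs.
Qed.

Lemma preimage_finType (V : finType) (Z : T -> V) (B : set V) :
  Z @^-1` B = \big[setU/set0]_(t <- index_enum V | `[<B t>]) Z @^-1` [set t].
Proof.
rewrite -bigcup_seq_cond predeqE => x; split=> [BZ|].
  by exists (Z x) => //=; rewrite mem_index_enum; exact/asboolP.
by move=> [v /= /andP[_ /asboolP Bv]] vE; rewrite /preimage/= vE.
Qed.

Lemma measurable_discrete_rv (V : finType) (Z : T -> V) (B : set V) :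
  discrete_rv Z -> measurable (Z @^-1` B).
Proof.
move=> mZ; rewrite preimage_finType.
by have [] := fine_measure_bigsetU (fun t => `[<B t>]) mZ (index_enum_uniq V).
Qed.

Lemma fine_measure_preimage (V : finType) (Z : T -> V) (B : set V) :
  discrete_rv Z -> fine (mu (Z @^-1` B)) = \sum_(t | `[<B t>]) law Z t.
Proof.
move=> mZ; rewrite preimage_finType.
by have [] := fine_measure_bigsetU (fun t => `[<B t>]) mZ (index_enum_uniq V).
Qed.

Lemma law_comp (V : finType) (W : eqType) (Z : T -> V) (h : V -> W) w :
  discrete_rv Z -> law (h \o Z) w = \sum_(t | h t == w) law Z t.
Proof.
move=> mZ; rewrite {1}/law comp_preimage fine_measure_preimage//.
by apply: eq_bigl => t; apply/asboolP/eqP.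
Qed.

Lemma sum_law (V : finType) (Z : T -> V) :
  discrete_rv Z -> \sum_t law Z t = 1.
Proof.
move=> mZ; have := @fine_measure_preimage V Z setT mZ.
rewrite preimage_setT probability_setT/= => ->.
by apply: eq_bigl => t; apply/esym/asboolP.
Qed.

Lemma sum_law_comp (V W : finType) (Z : T -> V) (h : V -> W) (F : W -> R) :
  discrete_rv Z -> \sum_w law (h \o Z) w * F w = \sum_t law Z t * F (h t).
Proof.
move=> mZ; rewrite [RHS](partition_big h xpredT)//=.
apply: eq_bigr => w _; rewrite law_comp// mulr_suml.
by apply: eq_bigr => t /eqP ->.
Qed.

Lemma discrete_rv_measurable_fun (V : finType) (Z : T -> V) (F : V -> R) :
  discrete_rv Z -> measurable_fun setT (F \o Z).
Proof.
by move=> mZ _ B mB; rewrite setTI comp_preimage; exact: measurable_discrete_rv.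
Qed.

Lemma bounded_Rintegrable (f : T -> R) (M : R) : measurable_fun setT f ->
  (forall x, `|f x| <= M) -> mu.-integrable setT (EFin \o f).
Proof.
move=> mf fM; apply: measurable_bounded_integrable => //.
  by rewrite (le_lt_trans (@probability_le1 _ _ _ mu setT measurableT)) ?ltry.
exists M; split; first by rewrite num_real.
by move=> K MK x _; exact: le_trans (fM x) (ltW MK).
Qed.

Lemma discrete_rv_integrable (V : finType) (Z : T -> V) (F : V -> R) :
  discrete_rv Z -> mu.-integrable setT (EFin \o (F \o Z)).
Proof.
move=> mZ; apply: (@bounded_Rintegrable _ (\sum_v `|F v|)).
  exact: discrete_rv_measurable_fun.
by move=> x /=; rewrite (bigD1 (Z x))//= lerDl sumr_ge0.
Qed.

Lemma Rintegral_law (V : finType) (Z : T -> V) (F : V -> R) :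
  discrete_rv Z -> \int[mu]_x F (Z x) = \sum_t law Z t * F t.
Proof.
move=> mZ; rewrite /Rintegral.
transitivity (fine (\int[mu]_x (\sum_t (F t * \1_(Z @^-1` [set t]) x)%:E))%E).
  congr fine; apply: eq_integral => x _; rewrite sumEFin; congr EFin.
  rewrite (bigD1 (Z x))//= indicE mem_set//= mulr1 big1 ?addr0// => t tZ.
  by rewrite indicE memNset ?mulr0//= => /esym/eqP; exact/negP.
have intF t : mu.-integrable setT (fun x => (F t * \1_(Z @^-1` [set t]) x)%:E).
  under [X in _.-integrable _ X]eq_fun do rewrite EFinM.
  by apply: integrableZl => //; exact: integrable_indic.
rewrite integral_sum// -[RHS]/(fine (_%:E)) -sumEFin; congr fine.
apply: eq_bigr => t _; under eq_integral do rewrite EFinM.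
rewrite integralZl//; last exact: integrable_indic.
rewrite integral_indic// setIT [in RHS]mulrC EFinM /law fineK//.
exact: fin_num_measure.
Qed.

End law.

(** * Cylinder sets, Borel sets and invariance *)

Section strings_measure.
Context {N : nat} {R : realType}.
Implicit Types u v : strings N.

Lemma open_strings_measurable (A : set (strings N)) : open A -> measurable A.
Proof. exact: sub_sigma_algebra. Qed.

Lemma pref_open q (B : set (q.-tuple 'I_N.+1)) : open (pref q @^-1` B).
Proof.
rewrite openE => u Bu; apply/nbhs_strings; exists q => v uv.
by rewrite /preimage/= -(_ : pref q u = pref q v)//; apply/pref_agree.
Qed.

Lemma pref_discrete_rv q : discrete_rv (@pref N q).
Proof. by move=> t; apply: open_strings_measurable; exact: pref_open. Qed.

Lemma continuous_strings_measurable (f : strings N -> R) :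
  continuous f -> measurable_fun setT f.
Proof.
move=> fc; apply: (measurability _ (RGenOpens.measurableE R)).
move=> _ [_ [a [b ->]] <-]; rewrite setTI; apply: open_strings_measurable.
by move/continuousP : fc; apply; exact: interval_open.
Qed.

Lemma measurable_shift : measurable_fun setT (@shift N).
Proof.
apply: (@measurability _ _ (strings N) (strings N) setT (@shift N) (@open (strings N)) erefl).
move=> _ [B oB <-]; rewrite setTI; apply: open_strings_measurable.
by move/continuousP: (@shift_continuous N); exact.
Qed.

Definition cylset : set (set (strings N)) :=
  [set A | exists q, forall u v, agree q u v -> A u -> A v].

Lemma cylset_le q r (A : set (strings N)) : (q <= r)%N ->
  (forall u v, agree q u v -> A u -> A v) ->
  (forall u v, agree r u v -> A u -> A v).
Proof. by move=> qr qA u v /(agree_le qr); exact: qA. Qed.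

Lemma cylset0 : cylset set0.
Proof. by exists 0%N. Qed.

Lemma cylsetT : cylset setT.
Proof. by exists 0%N. Qed.

Lemma cylsetC : setC_closed cylset.
Proof.
by move=> A [q qA]; exists q => u v uv Au /(qA _ _ (agree_sym uv)).
Qed.

Lemma cylsetI : setI_closed cylset.
Proof.
move=> A B [q qA] [r rB]; exists (maxn q r) => u v uv [Au Bu]; split.
  exact: (cylset_le (leq_maxl q r) qA _ Au).
exact: (cylset_le (leq_maxr q r) rB _ Bu).
Qed.

Lemma cylsetU : setU_closed cylset.
Proof.
move=> A B mA mB; rewrite -(setCK (A `|` B)) setCU.
by apply: cylsetC; apply: cylsetI; exact: cylsetC.
Qed.

Lemma cylset_open A : cylset A -> open A.
Proof.
move=> [q qA]; rewrite openE => u Au; apply: (proj2 (nbhs_strings u _)).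
by exists q => v uv; exact: qA Au.
Qed.

Lemma cylset_measurable A : cylset A -> measurable A.
Proof. by move/cylset_open; exact: open_strings_measurable. Qed.

Lemma cylset_pref A : cylset A ->
  exists q (B : set (q.-tuple 'I_N.+1)), A = pref q @^-1` B.
Proof.
move=> [q qA]; exists q, (pref q @` A); rewrite predeqE => u; split.
  by move=> Au; exists u.
by move=> [v Av /pref_agree vu]; exact: qA Av.
Qed.

Lemma open_cylset (A : set (strings N)) : open A ->
  exists2 F : (set (strings N))^nat, forall n, cylset (F n) & A = \bigcup_n F n.
Proof.
move=> oA; exists (fun n => [set u | forall v, agree n u v -> A v]).
  by move=> n; exists n => u v uv uA w vw; apply: uA; exact: agree_trans vw.
rewrite predeqE => u; split=> [Au|[n _]]; last by apply.
have /nbhs_strings[n nA] : nbhs u A by apply: open_nbhs_nbhs.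
by exists n.
Qed.

(** An open set is the union over n of the points whose cylinder of length n it contains. So the
    cylinder sets are a generating pi-system, for the uniqueness and the extension of measures
    alike. *)
Lemma measurable_cylset : @measurable _ (strings N) = <<s cylset >>.
Proof.
rewrite eqEsubset; split; apply: smallest_sub; try exact: smallest_sigma_algebra.
  move=> A /open_cylset[F cF ->]; apply: sigma_algebra_bigcup => n.
  exact: sub_sigma_algebra.
by move=> A /cylset_measurable.
Qed.

Variable mu : probability (strings N) R.

Lemma continuous_integrable (f : strings N -> R) : continuous f ->
  mu.-integrable setT (EFin \o f).
Proof.
move=> fc; have [M _ fM] := continuous_bounded fc.
by apply: bounded_Rintegrable fM; exact: continuous_strings_measurable.
Qed.

Lemma Rintegral_approx (V : finType) (Z : strings N -> V) (g : V -> R)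
    (f : strings N -> R) (e : R) : continuous f -> discrete_rv Z ->
  (forall u, `|f u - g (Z u)| <= e) ->
  `|\int[mu]_u f u - \sum_t law mu Z t * g t| <= e.
Proof.
move=> fc mZ H; rewrite -(Rintegral_law mu g mZ).
have cint : mu.-integrable setT (EFin \o cst e).
  by apply: (@bounded_Rintegrable _ _ _ _ _ `|e|) => // x; rewrite lexx.
have pint := discrete_rv_integrable mu g mZ.
have fint := continuous_integrable fc.
have cE : \int[mu]_x (cst e x) = e.
  rewrite Rintegral_cst//; transitivity (e * 1); last exact: mulr1.
  by congr (_ * _); exact: (congr1 fine (probability_setT mu)).
have le_add (f1 f2 : strings N -> R) : mu.-integrable setT (EFin \o f1) ->
    mu.-integrable setT (EFin \o f2) -> (forall u, f1 u <= f2 u + e) ->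
    \int[mu]_u f1 u <= \int[mu]_u f2 u + e.
  move=> i1 i2 f12; rewrite -[X in _ + X]cE -RintegralD//.
  by apply: le_Rintegral => //; exact: (integrableD measurableT i2 cint).
have := le_add _ _ fint pint; have := le_add _ _ pint fint.
rewrite /= ler_norml => h1 h2.
have {}h1 := h1 (fun u => ltac:(have := H u; rewrite ler_norml; lra)).
have {}h2 := h2 (fun u => ltac:(have := H u; rewrite ler_norml; lra)).
lra.
Qed.

Lemma Rintegral_modulus (f : strings N -> R) q e : continuous f ->
  modulus f q e ->
  `|\int[mu]_u f u - \sum_w law mu (pref q) w * f (pad w)| <= e.
Proof.
move=> fc fq; apply: (Rintegral_approx (g := fun w : q.-tuple _ => f (pad w))) => //.
  exact: pref_discrete_rv.
by move=> u; apply: fq; apply: agree_sym; exact: pad_pref.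
Qed.

(** The pushforward of [mu] by the shift and [mu] itself agree on a generating pi-system as soon as
    they agree on words. A failure of invariance is therefore seen on a single word. *)
Lemma invariantP : invariant mu <->
  forall q (w : q.-tuple 'I_N.+1), law mu (pref q \o shift) w = law mu (pref q) w.
Proof.
split=> [inv q w|lawE A mA].
  by rewrite /law comp_preimage inv//; exact: pref_discrete_rv.
have mZ q := @pref_discrete_rv q.
have mZ1 q : discrete_rv (pref q \o shift : strings N -> _).
  move=> t; rewrite comp_preimage -[X in measurable X]setTI.
  by apply: measurable_shift => //; exact: mZ.
pose smu : {measure set (strings N) -> \bar R} :=
  measure_function_pushforward__canonical__measure_function_Measure mu measurable_shift.
have fin_fineE (B : set (strings N)) : measurable B -> mu B = (fine (mu B))%:E.
  by move=> mB; rewrite fineK//; exact: fin_num_measure.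
suff : smu A = mu A by [].
apply: (@measure_unique _ R (strings N) cylset (fun=> setT) measurable_cylset
  cylsetI _ _ smu mu) => //.
- by move=> _; exact: cylsetT.
- by rewrite bigcup_const.
- move=> B cB; have [q [D BD]] := cylset_pref cB.
  have mB := cylset_measurable cB.
  have mB1 : measurable (shift @^-1` B).
    by rewrite -[X in measurable X]setTI; exact: measurable_shift.
  rewrite /smu /= /pushforward fin_fineE// [RHS]fin_fineE//; congr EFin.
  rewrite BD -comp_preimage !fine_measure_preimage//.
    by apply: eq_bigr => w _; exact: lawE.
  - exact: mZ.
  - exact: mZ1.
- move=> _; suff -> : smu setT = 1%E by exact: ltry.
  exact: probability_setT.
Qed.

End strings_measure.

(** * Entropy of finite laws *)

Section empirical_integral.
Context {N : nat} {R : realType}.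
Implicit Types u v : strings N.

Lemma law_empirical (V : eqType) (Z : strings N -> V) n u w : (0 < n)%N ->
  law (@empirical R N n u) Z w = n%:R^-1 * \sum_(k < n) (Z (iter k shift u) == w)%:R.
Proof.
move=> n0; rewrite /law empiricalE//.
under eq_bigr do rewrite diracE.
rewrite sumEFin -EFinM/=; congr (_ * _); apply: eq_bigr => k _.
congr ((nat_of_bool _)%:R); apply/idP/idP => [|/eqP <-]; first by rewrite inE => ->.
by rewrite inE.
Qed.

(** Both sides are compared with a sum over words of length q, where [law_empirical] counts visits;
    each comparison costs e / 2, for arbitrary e. *)
Lemma Rintegral_empirical (f : strings N -> R) n u : (0 < n)%N -> continuous f ->
  \int[@empirical R N n u]_v f v = n%:R^-1 * birkhoff_sum f n u.
Proof.
move=> n0 fc; apply/eqP; rewrite -subr_eq0 -normr_le0; apply/ler_addgt0Pl => e e0.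
rewrite addr0; have e20 : 0 < e / 2 by rewrite divr_gt0.
have [q fq] := uniform_modulus fc e20.
have := Rintegral_modulus (@empirical R N n u) fc fq.
have -> : \sum_w law (@empirical R N n u) (pref q) w * f (pad w) =
    n%:R^-1 * \sum_(k < n) f (pad (pref q (iter k shift u))).
  under eq_bigr do rewrite law_empirical// -mulrA mulr_suml.
  rewrite -mulr_sumr exchange_big/=; congr (_ * _); apply: eq_bigr => k _.
  rewrite (bigD1 (pref q (iter k shift u)))//= eqxx mul1r big1 ?addr0// => w wu.
  by rewrite eq_sym (negbTE wu) mul0r.
have : `|n%:R^-1 * \sum_(k < n) f (pad (pref q (iter k shift u))) -
         n%:R^-1 * birkhoff_sum f n u| <= e / 2.
  rewrite -mulrBr -sumrB normrM ger0_norm// ler_pdivrMl ?ltr0n//.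
  apply: le_trans (ler_norm_sum _ _ _) _.
  apply: (@le_trans _ _ (\sum_(k < n) e / 2)); last by rewrite sumr_const card_ord mulr_natl.
  by apply: ler_sum => k _; apply: fq => j jq; exact: pad_pref.
by rewrite !ler_norml; lra.
Qed.

End empirical_integral.

(** * Gibbs' inequality *)

Section gibbs.
Context {R : realType}.

Lemma ln_le_subr1 (x : R) : 0 < x -> ln x <= x - 1.
Proof.
by move=> x0; have := @le_ln1Dx R (x - 1); rewrite addrCA subrr addr0; apply; lra.
Qed.

(** Summing p (q / p - 1) bounds the difference by the mass of q minus 1, so q may be a
    subprobability. As [ln] is 0 at 0, q has to be positive wherever p is: a null q would otherwise
    count as costless. *)
Lemma gibbs (V : finType) (p q : V -> R) :
  (forall t, 0 <= p t) -> \sum_t p t = 1 ->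
  (forall t, 0 <= q t) -> \sum_t q t <= 1 -> (forall t, 0 < p t -> 0 < q t) ->
  - \sum_t p t * ln (p t) <= - \sum_t p t * ln (q t).
Proof.
move=> p0 p1 q0 q1 pq; rewrite lerN2 -subr_le0 -sumrB.
apply: (@le_trans _ _ (\sum_t (q t - p t))); last by rewrite sumrB p1 subr_le0.
apply: ler_sum => t _; rewrite -mulrBr.
have := p0 t; rewrite le_eqVlt => /predU1P[<-|pt0]; first by rewrite mul0r subr0.
have qt0 := pq _ pt0.
have -> : q t - p t = p t * (q t / p t - 1).
  by rewrite mulrBr mulr1 mulrCA divff ?mulr1// gt_eqF.
by rewrite ler_pM2l// -ln_div// ln_le_subr1// divr_gt0.
Qed.

Lemma sum_inj_le (V W : finType) (h : V -> W) (F : W -> R) :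
  injective h -> (forall w, 0 <= F w) -> \sum_t F (h t) <= \sum_w F w.
Proof.
move=> hinj F0; rewrite -(big_map h xpredT F).
rewrite big_uniq ?map_inj_uniq ?index_enum_uniq//=.
by rewrite [leRHS](bigID (fun w => w \in [seq h t | t <- index_enum V]))/= lerDl sumr_ge0.
Qed.

Context {d : measure_display} {T : measurableType d}.
Variable mu : probability T R.

Definition law_entropy (V : finType) (Z : T -> V) : R :=
  - \sum_t law mu Z t * ln (law mu Z t).

Lemma law_le_comp (V : finType) (W : eqType) (Z : T -> V) (h : V -> W) t :
  discrete_rv Z -> law mu Z t <= law mu (h \o Z) (h t).
Proof.
move=> mZ; rewrite law_comp// (bigD1 t)//= lerDl sumr_ge0// => i _.
exact: law_ge0.
Qed.

Lemma law_entropy_ge0 (V : finType) (Z : T -> V) :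
  discrete_rv Z -> 0 <= law_entropy Z.
Proof.
move=> mZ; rewrite oppr_ge0 sumr_le0// => t _.
by rewrite mulr_ge0_le0 ?law_ge0// ln_le0// law_le1.
Qed.

(** Passing to an image merges atoms, so the law increases and the entropy decreases; Gibbs'
    inequality then allows any subprobability q. Subadditivity and the guessing of labels below are
    two choices of q. *)
Lemma law_entropy_comp_le (V W : finType) (Z : T -> V) (h : V -> W) (q : V -> R) :
  discrete_rv Z -> (forall t, 0 <= q t) -> \sum_t q t <= 1 ->
  (forall t, 0 < law mu Z t -> 0 < q t) ->
  law_entropy (h \o Z) <= - \sum_t law mu Z t * ln (q t).
Proof.
move=> mZ q0 q1 pq; apply: (@le_trans _ _ (law_entropy Z)); last first.
  by apply: gibbs => // [t|]; [exact: law_ge0|exact: sum_law].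
rewrite /law_entropy (sum_law_comp mu h (fun w => ln (law mu (h \o Z) w)) mZ).
rewrite lerN2; apply: ler_sum => t _.
have := law_ge0 mu Z t; rewrite le_eqVlt => /predU1P[<-|pt0]; first by rewrite !mul0r.
rewrite ler_pM2l// ler_ln ?posrE ?law_le_comp//.
exact: lt_le_trans pt0 (law_le_comp h t mZ).
Qed.

End gibbs.

(** * Fekete's lemma *)

Section fekete.
Context {R : realType}.

Lemma subadditive_muln (a : nat -> R) : (forall n, 0 <= a n) ->
  (forall m n, a (m + n)%N <= a m + a n) ->
  forall k m r, a (k * m + r)%N <= k%:R * a m + a r.
Proof.
move=> a0 asub; elim=> [|k IH] m r; first by rewrite mul0n add0n mul0r add0r.
rewrite mulSn -addnA (le_trans (asub _ _))// -natr1 mulrDl mul1r.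
by have := IH m r; lra.
Qed.

(** With m almost minimizing a_m / m, dividing n by m leaves a remainder term bounded by [M], which
    n outgrows. The lower bound by every term is kept next to the limit: the comparison with H_m / m
    at fixed m rests on it. *)
Lemma fekete (a : nat -> R) : (forall n, 0 <= a n) ->
  (forall m n, a (m + n)%N <= a m + a n) ->
  exists2 l, n%:R^-1 * a n @[n --> \oo] --> l &
    forall m, (0 < m)%N -> l <= m%:R^-1 * a m.
Proof.
move=> a0 asub; pose E := [set m%:R^-1 * a m | m in [set m | (0 < m)%N]].
have E0 : E !=set0 by exists (1%:R^-1 * a 1%N); exists 1%N.
have lbE : lbound E 0 by move=> _ [m _ <-]; rewrite mulr_ge0.
have infE : has_inf E by split => //; exists 0.
have infP m : (0 < m)%N -> inf E <= m%:R^-1 * a m.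
  by move=> m0; apply: ge_inf; [exists 0|exists m].
exists (inf E) => //; apply/cvgrPdist_le => e e0.
have e20 : 0 < e / 2 by rewrite divr_gt0.
have [_ [m m0 <-] me] := inf_adherent e20 infE.
pose M := \sum_(r < m) a r.
have M0 : 0 <= M by rewrite sumr_ge0.
near=> n.
have n0 : (0 < n)%N by near: n; exists 1%N.
have nR : (0 : R) < n%:R by rewrite ltr0n.
have Mn : M <= n%:R * (e / 2).
  by rewrite mulrC -ler_pdivrMl//; near: n; exact: nbhs_infty_ger.
have mR : (0 : R) < m%:R by rewrite ltr0n.
have anE : n%:R^-1 * a n <= m%:R^-1 * a m + e / 2.
  rewrite ler_pdivrMl// mulrDr.
  have := subadditive_muln a0 asub (n %/ m) m (n %% m); rewrite -divn_eq.
  have -> : a (n %% m)%N = a (Ordinal (ltn_pmod n m0)) by [].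
  have : a (Ordinal (ltn_pmod n m0)) <= M.
    by rewrite /M (bigD1 (Ordinal (ltn_pmod n m0)))//= lerDl sumr_ge0.
  have : (n %/ m)%:R * a m <= n%:R * (m%:R^-1 * a m).
    rewrite mulrA ler_wpM2r// ler_pdivlMr// -natrM ler_nat.
    exact: leq_trunc_div.
  lra.
have := infP n n0; rewrite ler_norml; lra.
Unshelve. all: by end_near. Qed.

End fekete.

(** * Itineraries *)

Section itinerary.
Context {N : nat} {R : realType}.
Implicit Types u v : strings N.
Variable mu : probability (strings N) R.

Definition itinerary (B : Type) (lab : strings N -> B) n u : n.-tuple B :=
  [tuple lab (iter i shift u) | i < n].

Definition window (B : Type) (b0 : B) m j n (t : n.-tuple B) : m.-tuple B :=
  [tuple nth b0 t (j + i) | i < m].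

Lemma window_itinerary (B : Type) (lab : strings N -> B) b0 m j n u :
  (j + m <= n)%N ->
  window b0 m j (itinerary lab n u) = itinerary lab m (iter j shift u).
Proof.
move=> jmn; apply: eq_from_tnth => i; rewrite !tnth_mktuple.
have jin : (j + i < n)%N by rewrite (leq_trans _ jmn)// ltn_add2l.
rewrite -(tnth_nth _ _ (Ordinal jin)) tnth_mktuple /= addnC.
by rewrite iterD.
Qed.

Lemma pref_itinerary n u : pref n u = itinerary (fun u => u 0%N) n u.
Proof. by apply: eq_from_tnth => i; rewrite !tnth_mktuple iter_shiftE. Qed.

Lemma measurable_iter_shift j (A : set (strings N)) :
  measurable A -> measurable (iter j shift @^-1` A).
Proof.
elim: j A => [//|j IH] A mA.
rewrite (_ : _ @^-1` _ = iter j shift @^-1` (shift @^-1` A))//.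
by apply: IH; rewrite -[X in measurable X]setTI; exact: measurable_shift.
Qed.

Lemma itinerary_discrete_rv (B : Type) (lab : strings N -> B) n :
  discrete_rv lab -> discrete_rv (itinerary lab n).
Proof.
move=> mlab t.
rewrite (_ : _ @^-1` _ = \bigcap_(i in [set: 'I_n])
    (iter i shift @^-1` (lab @^-1` [set tnth t i]))).
  apply: fin_bigcap_measurable; first exact: finite_finset.
  by move=> i _; apply: measurable_iter_shift; exact: mlab.
rewrite predeqE => u; split=> [/= <- i _ /=|ut]; first by rewrite tnth_mktuple.
by apply: eq_from_tnth => i; rewrite tnth_mktuple; exact: (ut i I).
Qed.

Arguments itinerary_discrete_rv {B lab} n _ _.

Lemma discrete_rv_iter_shift (B : Type) (Z : strings N -> B) j :
  discrete_rv Z -> discrete_rv (Z \o iter j shift).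
Proof. by move=> mZ t; rewrite comp_preimage; exact: measurable_iter_shift. Qed.

Lemma discrete_rv_pair (B C : Type) (Y : strings N -> B) (Z : strings N -> C) :
  discrete_rv Y -> discrete_rv Z -> discrete_rv (fun u => (Y u, Z u)).
Proof.
move=> mY mZ [b c].
rewrite (_ : _ @^-1` _ = Y @^-1` [set b] `&` Z @^-1` [set c]).
  exact: measurableI.
by rewrite predeqE => u; split=> /= [[-> ->]|[-> ->]].
Qed.

Hypothesis inv : invariant mu.

Lemma invariant_iter j (A : set (strings N)) : measurable A ->
  mu (iter j shift @^-1` A) = mu A.
Proof.
elim: j A => [//|j IH] A mA.
rewrite (_ : _ @^-1` _ = iter j shift @^-1` (shift @^-1` A))//.
rewrite IH ?inv//.
by rewrite -[X in measurable X]setTI; exact: measurable_shift.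
Qed.

Lemma law_iter_shift (B : Type) (Z : strings N -> B) j : discrete_rv Z ->
  law mu (Z \o iter j shift) = law mu Z.
Proof. by move=> mZ; apply/funext => t; rewrite /law comp_preimage invariant_iter. Qed.

Lemma law_window (B : finType) (lab : strings N -> B) b0 m j n :
  discrete_rv lab -> (j + m <= n)%N ->
  law mu (@window B b0 m j n \o itinerary lab n) = law mu (itinerary lab m).
Proof.
move=> mlab jmn; rewrite -(law_iter_shift j (itinerary_discrete_rv m mlab)).
by congr law; apply/funext => u /=; exact: window_itinerary.
Qed.

Definition itinerary_entropy (B : finType) (lab : strings N -> B) n : R :=
  law_entropy mu (itinerary lab n).

Lemma window_split_inj (B : Type) (b0 : B) a b :
  injective (fun t : (a + b).-tuple B => (window b0 a 0 t, window b0 b a t)).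
Proof.
move=> s t st; have /= e1 := congr1 fst st; have /= e2 := congr1 snd st.
apply: eq_from_tnth => i; rewrite !(tnth_nth b0).
case: (ltnP i a) => ia.
  by have := congr1 (fun w => tnth w (Ordinal ia)) e1; rewrite !tnth_mktuple.
have iab : (i - a < b)%N by rewrite ltn_subLR.
have := congr1 (fun w => tnth w (Ordinal iab)) e2.
by rewrite !tnth_mktuple/= subnKC.
Qed.

(** Gibbs' inequality with q the product of the laws of the two windows. Cutting a tuple in two is
    injective, so q has mass at most 1, and invariance gives the window at offset a the law of an
    itinerary of length b. *)
Lemma itinerary_entropy_subadd (B : finType) (lab : strings N -> B) a b :
  discrete_rv lab ->
  itinerary_entropy lab (a + b) <= itinerary_entropy lab a + itinerary_entropy lab b.
Proof.
move=> mlab; have mZ n := itinerary_discrete_rv n mlab; have b0 := lab point.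
pose p n := law mu (itinerary lab n).
pose q (t : (a + b).-tuple B) := p a (window b0 a 0 t) * p b (window b0 b a t).
have wa := @law_window _ _ b0 a 0 (a + b) mlab (leq_addr b a).
have wb := @law_window _ _ b0 b a (a + b) mlab (leqnn _).
have pa t : 0 < p (a + b)%N t -> 0 < p a (window b0 a 0 t).
  move=> t0; apply: lt_le_trans t0 _; rewrite /p -wa.
  exact: (@law_le_comp _ _ _ mu _ _ _ (@window B b0 a 0 (a + b)) t (mZ _)).
have pb t : 0 < p (a + b)%N t -> 0 < p b (window b0 b a t).
  move=> t0; apply: lt_le_trans t0 _; rewrite /p -wb.
  exact: (@law_le_comp _ _ _ mu _ _ _ (@window B b0 b a (a + b)) t (mZ _)).
have q0 t : 0 <= q t by rewrite mulr_ge0// law_ge0.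
have q1 : \sum_t q t <= 1.
  pose F (w : a.-tuple B * b.-tuple B) := p a w.1 * p b w.2.
  apply: (@le_trans _ _ (\sum_w F w)).
    apply: (sum_inj_le (F := F) (@window_split_inj B b0 a b)) => w.
    by rewrite mulr_ge0// law_ge0.
  rewrite -(pair_big xpredT xpredT (fun w1 w2 => p a w1 * p b w2))/=.
  have psum n : \sum_w p n w = 1 by apply: sum_law; exact: mZ.
  by under eq_bigr do rewrite -mulr_sumr psum mulr1; rewrite psum.
apply: (le_trans (@law_entropy_comp_le _ _ _ mu _ _ _ id q (mZ _) q0 q1 _)).
  by move=> t t0; rewrite mulr_gt0 ?pa ?pb.
rewrite /itinerary_entropy /law_entropy -opprD lerN2 -/(p a) -/(p b).
have -> : \sum_w p a w * ln (p a w) =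
    \sum_t p (a + b)%N t * ln (p a (window b0 a 0 t)).
  by rewrite -(sum_law_comp mu (@window B b0 a 0 (a + b)) (fun w => ln (p a w)) (mZ _)) wa.
have -> : \sum_w p b w * ln (p b w) =
    \sum_t p (a + b)%N t * ln (p b (window b0 b a t)).
  by rewrite -(sum_law_comp mu (@window B b0 b a (a + b)) (fun w => ln (p b w)) (mZ _)) wb.
rewrite -big_split/=; apply: ler_sum => t _.
have : 0 <= p (a + b)%N t by exact: law_ge0.
rewrite -/(p (a + b)%N t) le_eqVlt => /predU1P[<-|t0]; first by rewrite !mul0r addr0.
by rewrite -mulrDr lnM// posrE ?pa ?pb.
Qed.

Lemma itinerary_entropy_ge0 (B : finType) (lab : strings N -> B) n :
  discrete_rv lab -> 0 <= itinerary_entropy lab n.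
Proof. by move=> mlab; apply: law_entropy_ge0; exact: itinerary_discrete_rv. Qed.

Lemma itinerary_entropy_cvg (B : finType) (lab : strings N -> B) :
  discrete_rv lab ->
  exists2 l, n%:R^-1 * itinerary_entropy lab n @[n --> \oo] --> l &
    forall m, (0 < m)%N -> l <= m%:R^-1 * itinerary_entropy lab m.
Proof.
move=> mlab; apply: fekete => [n|m n]; first exact: itinerary_entropy_ge0.
exact: itinerary_entropy_subadd.
Qed.

End itinerary.

(** * Approximation by cylinder sets *)

Section cylset_approximation.
Context {N : nat} {R : realType}.
Variable mu : probability (strings N) R.

Definition approximable (A : set (strings N)) := measurable A /\
  forall e : R, 0 < e -> exists C, cylset C /\
    (mu ((A `\` C) `|` (C `\` A)) <= e%:E)%E.

Lemma approximableC : setC_closed approximable.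
Proof.
move=> A [mA apA]; split; first exact: measurableC.
move=> e /apA[C [cC AC]]; exists (~` C); split; first exact: cylsetC.
by rewrite !setDE !setCK [_ `|` _]setUC [~` C `&` _]setIC [~` A `&` _]setIC.
Qed.

Lemma approximableU A B : approximable A -> approximable B ->
  approximable (A `|` B).
Proof.
move=> [mA apA] [mB apB]; split; first exact: measurableU.
move=> e e0; have e20 : 0 < e / 2 by rewrite divr_gt0.
have [C [cC AC]] := apA _ e20; have [D [cD BD]] := apB _ e20.
exists (C `|` D); split; first exact: cylsetU.
have mC := cylset_measurable cC; have mD := cylset_measurable cD.
have mAC : measurable ((A `\` C) `|` (C `\` A)).
  by apply: measurableU; exact: measurableD.
have mBD : measurable ((B `\` D) `|` (D `\` B)).
  by apply: measurableU; exact: measurableD.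
apply: (@le_trans _ _ (mu (((A `\` C) `|` (C `\` A)) `|` ((B `\` D) `|` (D `\` B))))).
  apply: le_measure; rewrite ?inE.
  - by apply: measurableU; apply: measurableD; exact: measurableU.
  - exact: measurableU.
  - by move=> u /=; tauto.
rewrite (le_trans (measureU2 _ _ _))// [e]splitr EFinD.
exact: leeD.
Qed.

Lemma approximable_bigcup (F : (set (strings N))^nat) :
  (forall n, approximable (F n)) -> approximable (\bigcup_n F n).
Proof.
move=> apF; have mF n := (apF n).1.
have mUF : measurable (\bigcup_n F n) by exact: bigcupT_measurable.
split=> // e e0; have e20 : 0 < e / 2 by rewrite divr_gt0.
pose G n := \big[setU/set0]_(i < n.+1) F i.
have apG n : approximable (G n).
  rewrite /G; elim: n => [|n IH]; first by rewrite big_ord1.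
  by rewrite big_ord_recr; exact: approximableU.
have mG n := (apG n).1.
have GE n : G n = \bigcup_(i in `I_n.+1) F i by rewrite /G bigcup_mkord.
have UG : \bigcup_n G n = \bigcup_n F n.
  rewrite predeqE => u; split=> [[n _]|[n _ Fu]].
    by rewrite GE => -[i _ Fu]; exists i.
  by exists n => //; rewrite GE; exists n => //=.
have ndG : nondecreasing_seq G.
  move=> m n mn; apply/subsetPset; rewrite !GE => u [i /= im Fu].
  by exists i => //=; exact: leq_trans im _.
have : mu \o G @ \oo --> (fine (mu (\bigcup_n F n)))%:E.
  rewrite fineK; last exact: fin_num_measure.
  by rewrite -UG; apply: nondecreasing_cvg_mu; rewrite ?UG.
move=> /fine_cvgP[_] /cvgrPdist_le/(_ _ e20) -[n _ /(_ n (leqnn n)) /= Gn].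
have [C [cC GC]] := (apG n).2 _ e20; exists C; split=> //.
have mC := cylset_measurable cC.
have GU : G n `<=` \bigcup_n F n by rewrite -UG; exact: bigcup_sup.
have mUG : (mu (\bigcup_n F n `\` G n) <= (e / 2)%:E)%E.
  rewrite measureD//; last first.
    by rewrite (le_lt_trans (@probability_le1 _ _ _ mu _ mUF)) ?ltry.
  rewrite (_ : _ `&` _ = G n); last exact/setIidPr.
  apply: (@le_trans _ _ (fine (mu (\bigcup_n F n)) - fine (mu (G n)))%:E).
    by rewrite EFinB !fineK; [exact: lexx|exact: fin_num_measure..].
  by rewrite lee_fin; exact: le_trans (ler_norm _) Gn.
have mGC : measurable ((G n `\` C) `|` (C `\` G n)).
  by apply: measurableU; exact: measurableD.
apply: (@le_trans _ _ (mu ((\bigcup_n F n `\` G n) `|`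
    ((G n `\` C) `|` (C `\` G n))))).
  apply: le_measure; rewrite ?inE.
  - by apply: measurableU; exact: measurableD.
  - by apply: measurableU => //; exact: measurableD.
  - move=> u [[UFu nC]|[Cu nUF]].
      by have [Gu|nG] := pselect (G n u); [right; left|left].
    by right; right; split=> // /GU.
rewrite (le_trans (measureU2 _ _ _))//; first exact: measurableD.
by rewrite [e]splitr EFinD; exact: leeD.
Qed.

(** The approximable sets form a sigma-algebra that contains the cylinder sets. *)
Lemma measurable_approximable A : measurable A -> approximable A.
Proof.
rewrite measurable_cylset; apply: smallest_sub => [|B cB].
  split=> [|B|F].
  - split; first exact: measurable0.
    by move=> e e0; exists set0; split; [exact: cylset0|
      rewrite setD0 setU0 measure0 lee_fin ltW].
  - by rewrite setTD; exact: approximableC.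
  - exact: approximable_bigcup.
split; first exact: cylset_measurable.
by move=> e e0; exists B; split=> //; rewrite setDv setU0 measure0 lee_fin ltW.
Qed.

(** Each of the k fibres is approximated within e / k by a cylinder set, and L is long enough to
    decide all these sets. The guess is some label whose set contains the word, [a0] if there is
    none. *)
Lemma label_approximation (K : finType) (lab : strings N -> K) (e : R) :
  discrete_rv lab -> 0 < e -> exists L (f : L.-tuple 'I_N.+1 -> K),
    \sum_(t | t.1 != f t.2) law mu (fun u => (lab u, pref L u)) t <= e.
Proof.
move=> mlab e0; pose k := #|K|; have a0 := lab point.
have k0 : (0 < k)%N by apply/card_gt0P; exists a0.
have ek0 : 0 < e / k%:R by rewrite divr_gt0// ltr0n.
have /choice[C CP] : forall a, exists C, cylset C /\
    (mu ((lab @^-1` [set a] `\` C) `|` (C `\` lab @^-1` [set a])) <= (e / k%:R)%:E)%E.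
  by move=> a; have [_] := measurable_approximable (mlab a); apply.
have /choice[Q QP] : forall a, exists q, forall u v, agree q u v -> C a u -> C a v.
  by move=> a; have [] := CP a.
pose L := \max_a Q a.
have CL a u : C a (pad (pref L u)) <-> C a u.
  have QL : (Q a <= L)%N by exact: leq_bigmax.
  split; apply: QP; apply: (agree_le QL); first exact: pad_pref.
  by apply: agree_sym; exact: pad_pref.
pose f (w : L.-tuple 'I_N.+1) : K := odflt a0 [pick a | `[< C a (pad w) >]].
exists L, f.
have mC a := cylset_measurable (CP a).1.
pose D a := (lab @^-1` [set a] `\` C a) `|` (C a `\` lab @^-1` [set a]).
have mD a : measurable (D a).
  by apply: measurableU; apply: measurableD.
have mZ : discrete_rv (fun u => (lab u, pref L u)).
  by apply: discrete_rv_pair => //; exact: pref_discrete_rv.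
pose B := (fun u => (lab u, pref L u)) @^-1` [set t | t.1 != f t.2].
have mB : measurable B := measurable_discrete_rv mu _ mZ.
have <- : fine (mu B) =
    \sum_(t | t.1 != f t.2) law mu (fun u => (lab u, pref L u)) t.
  by rewrite fine_measure_preimage//; apply: eq_bigl => t; rewrite asboolb.
rewrite -lee_fin fineK; last exact: fin_num_measure.
apply: (@le_trans _ _ (mu (\big[setU/set0]_(a : K) D a))).
  apply: le_measure; rewrite ?inE//.
  - by apply: bigsetU_measurable.
  (* A wrong guess puts u in some [D a]: that of the true label if u escapes its cylinder set, else
     that of the label which [pick] returned instead. *)
  - move=> u /= labf; rewrite -bigcup_seq.
    have [Cu|nCu] := pselect (C (lab u) u); last first.
      by exists (lab u) => /=; [exact: mem_index_enum|left].
    move: labf; rewrite /B /preimage /= /f.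
    case: (pickP (fun a => `[< C a (pad (pref L u)) >])) =>
      [a /asboolP /CL Ca /= la|]; last first.
      by move=> /(_ (lab u))/negP; case; apply/asboolP/CL.
    exists a => /=; first exact: mem_index_enum.
    by right; split=> //=; exact/eqP.
apply: (@le_trans _ _ (\sum_(a : K) mu (D a))%E).
  rewrite /index_enum; elim: (locked_with _ _) => [|a s IH].
    by rewrite !big_nil measure0.
  rewrite !big_cons; apply: (le_trans (measureU2 _ (mD a) (bigsetU_measurable _ _))) => //.
  exact: leeD.
apply: (@le_trans _ _ (\sum_(a : K) (e / k%:R)%:E)%E).
  by apply: lee_sum => a _; exact: (CP a).2.
rewrite sumEFin sumr_const lee_fin -[leLHS]mulr_natr.
have -> : #|(xpredT : pred K)| = k by exact: eq_card.
by rewrite mulfVK// pnatr_eq0 -lt0n.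
Qed.

End cylset_approximation.

(** * The Kolmogorov-Sinai bound *)

Lemma ln_prod (R : realType) (I : Type) (s : seq I) (P : pred I) (F : I -> R) :
  (forall i, 0 < F i) -> ln (\prod_(i <- s | P i) F i) = \sum_(i <- s | P i) ln (F i).
Proof.
move=> F0; have F0s r : 0 < \prod_(i <- r | P i) F i by apply: prodr_gt0.
elim: s => [|i s IH]; first by rewrite !big_nil ln1.
by rewrite !big_cons; case: ifP => // _; rewrite lnM ?posrE// IH.
Qed.

Section kolmogorov_sinai.
Context {N : nat} {R : realType}.
Variable mu : probability (strings N) R.

Lemma sum_tuple_prod (K : finType) n (F : 'I_n -> K -> R) :
  \sum_(v : n.-tuple K) \prod_(j < n) F j (tnth v j) = \prod_(j < n) \sum_a F j a.
Proof.
rewrite bigA_distr_bigA /=.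
rewrite (reindex (fun g : {ffun 'I_n -> K} => [tuple g j | j < n])) /=.
  apply: eq_bigr => g _; apply: eq_bigr => j _; by rewrite tnth_mktuple.
exists (fun v => [ffun j => tnth v j]) => [g _|v _].
  by apply/ffunP => j; rewrite ffunE tnth_mktuple.
by apply: eq_from_tnth => j; rewrite tnth_mktuple ffunE.
Qed.

Lemma letter_discrete_rv : discrete_rv (fun u : strings N => u 0%N).
Proof.
move=> a; apply: cylset_measurable; exists 1%N => u v uv /= <-.
by rewrite uv.
Qed.

Lemma pref_itineraryE n : @pref N n = itinerary (fun u => u 0%N) n.
Proof. by apply/funext => u; exact: pref_itinerary. Qed.

Hypothesis inv : invariant mu.

Section label.
Variables (K : finType) (lab : strings N -> K) (L : nat).
Variables (f : L.-tuple 'I_N.+1 -> K) (eta : R).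
Hypothesis mlab : discrete_rv lab.
Hypothesis eta01 : 0 < eta < 1.

Let card_gt0 : 0 < #|K|%:R :> R.
Proof. by rewrite ltr0n; apply/card_gt0P; exists (lab point). Qed.

(* Conditional law of the label given the first L letters, believed to be f. *)
Let guess (w : L.-tuple 'I_N.+1) (a : K) : R :=
  if a == f w then 1 - eta else eta / #|K|%:R.

Let guess_gt0 w a : 0 < guess w a.
Proof.
move: eta01 => /andP[eta0 eta1]; rewrite /guess; case: ifP => _.
  by rewrite subr_gt0.
by rewrite divr_gt0.
Qed.

Let sum_guess w : \sum_a guess w a <= 1.
Proof.
move: eta01 => /andP[eta0 eta1].
apply: (@le_trans _ _ (\sum_a ((if a == f w then 1 - eta else 0) + eta / #|K|%:R))).
  apply: ler_sum => a _; rewrite /guess; case: ifP => _; last by rewrite add0r.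
  by rewrite lerDl ltW// divr_gt0.
rewrite big_split/= -big_mkcond big_pred1_eq sumr_const -[X in _ + X]mulr_natr.
have -> : #|(xpredT : pred K)| = #|K| by exact: eq_card.
by rewrite mulfVK ?gt_eqF// subrK.
Qed.

Let guess_cost w a :
  - ln (guess w a) <= - ln (1 - eta) + (a != f w)%:R * ln (#|K|%:R / eta).
Proof.
move: eta01 => /andP[eta0 eta1]; rewrite /guess; case: ifP => _ /=.
  by rewrite mul0r addr0.
rewrite mul1r -lnV ?posrE ?divr_gt0// invf_div lerDr oppr_ge0 ln_le0//.
by rewrite lerBlDr lerDl ltW.
Qed.

Definition label_error :=
  \sum_(t | t.1 != f t.2) law mu (fun u => (lab u, pref L u)) t.

(** The n labels are described by a word of n + L letters, long enough for the L letters from each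
    time j < n on, together with one guess per label. Gibbs' inequality is applied to this pair and
    projected to the labels; by invariance every guess has the same mean cost. *)
Lemma itinerary_entropy_guess n :
  itinerary_entropy mu lab n <= law_entropy mu (@pref N (n + L)) +
    n%:R * (- ln (1 - eta) + label_error * ln (#|K|%:R / eta)).
Proof.
pose Z (u : strings N) := (itinerary lab n u, pref (n + L) u).
have mZ : discrete_rv Z.
  by apply: discrete_rv_pair; [exact: itinerary_discrete_rv|exact: pref_discrete_rv].
pose win (j : 'I_n) (w : (n + L).-tuple 'I_N.+1) := window ord0 L j w.
pose p := law mu (@pref N (n + L)).
pose q (t : n.-tuple K * (n + L).-tuple 'I_N.+1) :=
  p t.2 * \prod_(j < n) guess (win j t.2) (tnth t.1 j).
have prod_gt0 t : 0 < \prod_(j < n) guess (win j t.2) (tnth t.1 j).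
  by apply: prodr_gt0.
have q0 t : 0 <= q t by rewrite mulr_ge0 ?law_ge0// ltW.
have q1 : \sum_t q t <= 1.
  rewrite -(pair_big xpredT xpredT (fun v w => q (v, w)))/= exchange_big/=.
  apply: (@le_trans _ _ (\sum_w p w)); last by rewrite sum_law//; exact: pref_discrete_rv.
  apply: ler_sum => w _; rewrite /q /= -mulr_sumr ler_piMr ?law_ge0//.
  rewrite (sum_tuple_prod (fun j => guess (win j w))); apply: prodr_ile1 => j _.
  by rewrite sum_guess sumr_ge0// => a _; rewrite ltW.
have pZ t : 0 < law mu Z t -> 0 < p t.2.
  by move=> t0; apply: lt_le_trans t0 _; exact: (law_le_comp mu snd t mZ).
apply: (le_trans (@law_entropy_comp_le _ _ _ mu _ _ Z fst q mZ q0 q1 _)).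
  by move=> t /pZ t0; rewrite mulr_gt0.
have -> : law_entropy mu (@pref N (n + L)) = - \sum_t law mu Z t * ln (p t.2).
  by rewrite /law_entropy -(sum_law_comp mu snd (fun w => ln (p w)) mZ).
have costE (j : 'I_n) : \sum_t law mu Z t * - ln (guess (win j t.2) (tnth t.1 j)) <=
    - ln (1 - eta) + label_error * ln (#|K|%:R / eta).
  pose h (t : n.-tuple K * (n + L).-tuple 'I_N.+1) := (tnth t.1 j, win j t.2).
  pose Y u := (lab u, pref L u).
  have mY : discrete_rv Y by apply: discrete_rv_pair => //; exact: pref_discrete_rv.
  have hZ : h \o Z = Y \o iter j shift.
    apply/funext => u; rewrite /h /Z /Y /=; congr pair; first by rewrite tnth_mktuple.
    rewrite !pref_itineraryE /win window_itinerary//.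
    by rewrite leq_add2r ltnW.
  rewrite -(sum_law_comp mu h (fun t => - ln (guess t.2 t.1)) mZ) hZ law_iter_shift//.
  apply: (@le_trans _ _ (\sum_t law mu Y t * (- ln (1 - eta) +
      (t.1 != f t.2)%:R * ln (#|K|%:R / eta)))).
    by apply: ler_sum => t _; rewrite ler_wpM2l ?law_ge0.
  under eq_bigr do rewrite mulrDr mulrA.
  rewrite big_split/= -!mulr_suml sum_law// mul1r.
  rewrite lerD2l le_eqVlt; apply/orP; left; apply/eqP; congr (_ * _).
  rewrite /label_error [RHS]big_mkcond/=; apply: eq_bigr => t _.
  by case: ifP; rewrite ?mulr1 ?mulr0.
have -> : n%:R * (- ln (1 - eta) + label_error * ln (#|K|%:R / eta)) =
    \sum_(j < n) (- ln (1 - eta) + label_error * ln (#|K|%:R / eta)).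
  by rewrite sumr_const card_ord mulr_natl.
apply: (@le_trans _ _ (- \sum_t law mu Z t * ln (p t.2) +
    \sum_(j < n) \sum_t law mu Z t * - ln (guess (win j t.2) (tnth t.1 j)))); last first.
  by rewrite lerD2l; apply: ler_sum => j _; exact: costE.
rewrite exchange_big/= -sumrN -sumrN -big_split/=; apply: ler_sum => t _.
have := law_ge0 mu Z t; rewrite le_eqVlt => /predU1P[<-|t0].
  by rewrite !mul0r oppr0 add0r big1// => j _; rewrite mul0r.
rewrite -mulr_sumr sumrN mulrN -opprD lerN2 -mulrDr ler_pM2l//.
rewrite lnM ?posrE ?pZ// lerD2l.
by rewrite ln_prod.
Qed.

End label.

Definition word_entropy n : R := law_entropy mu (@pref N n).

Lemma word_entropyE n : word_entropy n = itinerary_entropy mu (fun u => u 0%N) n.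
Proof. by rewrite /word_entropy pref_itineraryE. Qed.

Lemma word_entropy_cvg :
  exists2 l, n%:R^-1 * word_entropy n @[n --> \oo] --> l &
    forall m, (0 < m)%N -> l <= m%:R^-1 * word_entropy m.
Proof.
have [l ll lm] := itinerary_entropy_cvg inv letter_discrete_rv.
exists l; last by move=> m; rewrite word_entropyE; exact: lm.
by under eq_fun do rewrite word_entropyE.
Qed.

(** Dividing the guessing bound by n makes the L extra letters negligible; only the cost of the
    guesses survives, and it is arbitrarily small. *)
Lemma itinerary_entropy_le_word (K : finType) (lab : strings N -> K) (l : R) m :
  discrete_rv lab -> n%:R^-1 * itinerary_entropy mu lab n @[n --> \oo] --> l ->
  (0 < m)%N -> l <= m%:R^-1 * word_entropy m.
Proof.
move=> mlab labl m0; have [lw lwl lwm] := word_entropy_cvg.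
apply: le_trans (lwm _ m0); apply/ler_addgt0Pl => e e0.
have e40 : 0 < e / 4 by rewrite divr_gt0.
(* A right guess thus costs e / 4. Since [eta] fixes [c] before L and f are chosen, the label error
   can be made small against [c]; the 1 in c + 1 avoids a division by 0. *)
pose eta : R := 1 - expR (- (e / 4)).
have eta01 : 0 < eta < 1.
  by rewrite subr_gt0 expR_lt1 oppr_lt0 e40 ltrBlDr ltrDl expR_gt0.
have etaE : - ln (1 - eta) = e / 4 by rewrite opprB addrC subrK expRK opprK.
pose c := ln (#|K|%:R / eta).
have c0 : 0 <= c.
  case/andP: eta01 => eta0 eta1.
  rewrite ln_ge0// ler_pdivlMr// mul1r (le_trans (ltW eta1))// ler1n.
  by apply/card_gt0P; exists (lab point).
have [|L [f fe]] := @label_approximation _ _ mu _ lab (e / 4 / (c + 1)) mlab.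
  by rewrite divr_gt0// ltr_wpDl.
have fc : label_error lab f * c <= e / 4.
  apply: (@le_trans _ _ (e / 4 / (c + 1) * c)); first by rewrite ler_wpM2r.
  by rewrite -mulrA ler_piMr ?(ltW e40)// ler_pdivrMl ?ltr_wpDl// mulr1 lerDl.
near \oo => n.
have n0 : (0 < n)%N by near: n; exists 1%N.
have nR : (0 : R) < n%:R by rewrite ltr0n.
have h1 : `|lw - n%:R^-1 * word_entropy n| <= e / 4.
  by near: n; move/cvgrPdist_le : lwl; exact.
have h2 : `|l - n%:R^-1 * itinerary_entropy mu lab n| <= e / 4 / 2.
  by near: n; move/cvgrPdist_le : labl; apply; rewrite divr_gt0.
have h3 : word_entropy L <= n%:R * (e / 4 / 2).
  by rewrite mulrC -ler_pdivrMl ?divr_gt0//; near: n; exact: nbhs_infty_ger.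
have h4 := itinerary_entropy_guess f mlab eta01 n.
have h5 : word_entropy (n + L) <= word_entropy n + word_entropy L.
  rewrite !word_entropyE; exact: itinerary_entropy_subadd letter_discrete_rv.
have : n%:R^-1 * itinerary_entropy mu lab n <=
    n%:R^-1 * word_entropy n + (e / 4 / 2 + (e / 4 + e / 4)).
  rewrite ler_pdivrMl// mulrDr mulVKf ?gt_eqF//.
  apply: (le_trans h4); rewrite etaE -/c -/(word_entropy _).
  have : n%:R * (e / 4 + label_error lab f * c) <= n%:R * (e / 4 + e / 4).
    by rewrite ler_pM2l// lerD2l.
  by rewrite [in leRHS]mulrDr; lra.
move: h1 h2; rewrite !ler_norml; lra.
Unshelve. all: by end_near. Qed.

Lemma join_entropyE k (P : 'I_k -> set (strings N)) (lab : strings N -> 'I_k) n :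
  (forall a u, P a u <-> lab u = a) ->
  join_entropy mu P n = itinerary_entropy mu lab n.
Proof.
move=> Plab; rewrite /join_entropy /itinerary_entropy /law_entropy; congr (- _).
apply: eq_bigr => w _; rewrite /= /law.
rewrite (_ : join_cell P w = itinerary lab n @^-1` [set w])//.
rewrite predeqE => u; split=> [uw|/= <- j].
  by apply: eq_from_tnth => j; rewrite tnth_mktuple; exact/Plab/uw.
by apply/Plab; rewrite tnth_mktuple.
Qed.

Lemma finite_partition_label k (P : 'I_k -> set (strings N)) :
  finite_partition P ->
  exists2 lab, discrete_rv lab & forall a u, P a u <-> lab u = a.
Proof.
move=> [mP tP PT].
have /choice[lab labP] : forall u, exists a, P a u.
  move=> u; have : [set: strings N] u by [].
  by rewrite -PT => -[a _ Pau]; exists a.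
have labE a u : P a u <-> lab u = a.
  split=> [Pau|<-//]; apply: contrapT => /eqP labu.
  move/trivIsetP : tP => /(_ (lab u) a I I labu).
  by rewrite predeqE => /(_ u)[+ _]; apply; split.
exists lab => // a; rewrite (_ : _ @^-1` _ = P a)//.
by rewrite predeqE => u; split=> /labE.
Qed.

Lemma partition_entropy_le_word k (P : 'I_k -> set (strings N)) m :
  finite_partition P -> (0 < m)%N ->
  partition_entropy mu P <= m%:R^-1 * word_entropy m.
Proof.
move=> /finite_partition_label[lab mlab Plab] m0.
have [l ll _] := itinerary_entropy_cvg inv mlab.
rewrite /partition_entropy; under eq_fun do rewrite (join_entropyE _ Plab).
by rewrite (cvg_lim _ ll)//; exact: itinerary_entropy_le_word ll m0.
Qed.

(** The partition by first letters has words as its itineraries, so its entropy is the limit of H_m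
    / m. *)
Lemma le_entropy (t : R) : (forall m, (0 < m)%N ->
  t <= m%:R^-1 * word_entropy m) -> (t%:E <= entropy mu)%E.
Proof.
move=> tw; have [l ll _] := word_entropy_cvg.
have tl : t <= l.
  apply: cvgr_to_ge ll _; exists 1%N => // m /= m0; exact: tw.
apply: (@le_trans _ _ l%:E); first by rewrite lee_fin.
pose P (a : 'I_N.+1) := [set u : strings N | u 0%N = a].
have Plab a u : P a u <-> u 0%N = a by [].
apply: ereal_sup_ubound; exists N.+1, P; split.
  split; first exact: letter_discrete_rv.
    by apply/trivIsetP => a b _ _ /eqP ab; rewrite -subset0 => u [Pa Pb]; apply: ab; rewrite -Pa -Pb.
  by rewrite predeqE => u; split=> // _; exists (u 0%N).
congr EFin; rewrite /partition_entropy.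
under eq_fun do rewrite (join_entropyE _ Plab) -word_entropyE.
by rewrite (cvg_lim _ ll).
Qed.

End kolmogorov_sinai.

(** * Compactness for the weak topology *)

Section weak_nbhs.
Context {N : nat} {R : realType}.
Implicit Types mu nu : weak_probability R N.

Definition close_on (f : strings N -> R) (e : R) mu : set (weak_probability R N) :=
  [set nu : weak_probability R N | `|\int[nu]_u f u - \int[mu]_u f u| <= e].

Lemma weak_cvg mu (F : set_system (weak_probability R N)) : Filter F ->
  (forall f e, continuous f -> 0 < e -> F (close_on f e mu)) ->
  F --> mu.
Proof.
move=> FF Fmu A [_ [[B oB <-] /= Bmu BA]].
have GF : Filter ((@integrals R N) @ F) by exact: fmap_filter.
suff : (@integrals R N) @ F --> integrals mu.
  by move=> /(_ B (open_nbhs_nbhs (conj oB Bmu))) FB; exact: filterS BA FB.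
apply/cvg_sup => f; apply/cvg_image => //.
  by rewrite predeqE => a; split=> // _; exists (fun=> a).
move=> D /nbhs_ballP[e /= e0 De].
have e20 : 0 < e / 2 by rewrite divr_gt0.
exists ((fun w => w f) @^-1` D); last first.
  rewrite image_preimage//.
  by rewrite predeqE => a; split=> // _; exists (fun=> a).
suff : F [set nu : weak_probability R N | D (integrals nu f)] by [].
apply: filterS (Fmu _ _ (svalP f) e20) => nu nue.
have e2e : e / 2 < e by lra.
by apply: De; rewrite /ball/= distrC; exact: le_lt_trans nue e2e.
Qed.

Lemma close_on_nbhs mu (f : strings N -> R) (e : R) : continuous f -> 0 < e ->
  nbhs mu (close_on f e mu).
Proof.
move=> fc e0.
have ic := @initial_continuous _ _ (@integrals R N) mu.
pose g : {f : strings N -> R | continuous f} := exist _ f fc.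
have FF : Filter (integrals (N:=N) @ nbhs mu) by exact: fmap_filter.
move/cvg_sup : ic => /(_ g) ic.
have gc := @initial_continuous _ R
  (fun w : (forall _ : {f : strings N -> R | continuous f}, R) => w g) (integrals mu).
have : nbhs mu [set nu : weak_probability R N | ball (integrals mu g) e (integrals nu g)].
  exact: ic _ (gc _ (nbhsx_ballx _ e e0)).
apply: (@filterS _ (nbhs mu)) => nu; rewrite /close_on /ball/= distrC => nue.
exact: ltW.
Qed.

(** Finite families of continuous functions with a tolerance generate a filter, which converges to
    mu by [weak_cvg] and so contains every neighbourhood. *)
Lemma weak_nbhs mu (W : set (weak_probability R N)) : nbhs mu W ->
  exists fs : seq (strings N -> R), exists2 e : R, 0 < e &
    (forall f, f \in fs -> continuous f) /\
    forall nu, (forall f, f \in fs -> close_on f e mu nu) -> W nu.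
Proof.
move=> muW.
pose D := [set p : seq (strings N -> R) * R | 0 < p.2 /\
  forall f, f \in p.1 -> continuous f].
pose B (p : seq (strings N -> R) * R) :=
  [set nu | forall f, f \in p.1 -> close_on f p.2 mu nu].
have GF : Filter (filter_from D B).
  apply: filter_from_filter; first by exists ([::], 1); split.
  move=> [fs e] [gs e'] [/= e0 fsc] [/= e'0 gsc].
  exists (fs ++ gs, Num.min e e').
    split; first by rewrite lt_min e0.
    by move=> f /=; rewrite mem_cat => /orP[/fsc|/gsc].
  move=> nu nuP; split=> f /= ffs.
    have := nuP f; rewrite /= mem_cat ffs => /(_ isT).
    by rewrite /close_on /= le_min => /andP[].
  have := nuP f; rewrite /= mem_cat ffs orbT => /(_ isT).
  by rewrite /close_on /= le_min => /andP[].
have : filter_from D B --> mu.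
  apply: weak_cvg => f e fc e0; exists ([:: f], e).
    by split=> // g /=; rewrite inE => /eqP ->.
  by move=> nu /= /(_ f); rewrite inE eqxx; apply.
move=> /(_ _ muW)[[fs e] [/= e0 fsc] BW].
by exists fs, e.
Qed.

End weak_nbhs.

Definition cylset_display : measure_display. Proof. exact: default_measure_display. Qed.

(* The carrier of strings N, with the algebra of cylinder sets instead of the
   Borel sets. *)
Definition cylset_strings (N : nat) : Type := strings N.

HB.instance Definition _ N := Pointed.on (cylset_strings N).

HB.instance Definition _ N := @isAlgebraOfSets.Build cylset_display
  (cylset_strings N) (@cylset N) (@cylset0 N) (@cylsetU N) (@cylsetC N).

(** * From contents on cylinder sets to Borel probabilities *)

Section content_extension.
Context {N : nat} {R : realType}.
Variable l : set (strings N) -> R.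
Hypothesis l_ge0 : forall A, 0 <= l A.
Hypothesis l0 : l set0 = 0.
Hypothesis lU : forall A B, cylset A -> cylset B -> [disjoint A & B] ->
  l (A `|` B) = l A + l B.

Definition cylset_content (A : set (cylset_strings N)) : \bar R := (l A)%:E.

Let content0 : cylset_content set0 = 0%E.
Proof. by rewrite /cylset_content l0. Qed.

Let content_ge0 A : (0 <= cylset_content A)%E.
Proof. by rewrite lee_fin. Qed.

Let cylset_bigsetU (F : (set (strings N))^nat) n : (forall i, cylset (F i)) ->
  cylset (\big[setU/set0]_(i < n) F i).
Proof.
move=> cF; elim: n => [|n IH]; first by rewrite big_ord0; exact: cylset0.
by rewrite big_ord_recr/=; exact: cylsetU.
Qed.

Let l_bigsetU (F : (set (strings N))^nat) n : (forall i, cylset (F i)) ->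
  trivIset setT F -> l (\big[setU/set0]_(i < n) F i) = \sum_(i < n) l (F i).
Proof.
move=> cF tF; elim: n => [|n IH]; first by rewrite !big_ord0.
rewrite !big_ord_recr/= lU ?IH//; first exact: cylset_bigsetU.
apply/disj_set2P; rewrite -subset0 -bigcup_mkord => u [[i /= ik Fi] Fn].
have ni : i != n by rewrite ltn_eqF.
by move/trivIsetP : tF => /(_ i n I I ni); rewrite predeqE => /(_ u)[+ _]; apply.
Qed.

(* A cylinder set is compact, so that it is a finite union of the F i. *)
Let content_semi_sigma_additive : semi_sigma_additive cylset_content.
Proof.
move=> F mF tF mUF.
have [q qU] := mUF.
have [||n nP] := @cover_strings N
    (fun n u => (\bigcup_i F i) u -> exists2 i, (i < n)%N & F i u).
- move=> m n u mn mP /mP[i im Fi]; exists i => //; exact: leq_trans im mn.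
- move=> u; have [[i _ Fiu]|nFu] := pselect ((\bigcup_i F i) u).
    have [qi qF] := mF i; exists (maxn qi i.+1) => v uv _; exists i.
      by rewrite (leq_trans (ltnSn i))// leq_maxr.
    exact: (cylset_le (leq_maxl _ _) qF uv).
  by exists q => v uv Fv; case: nFu; exact: qU (agree_sym uv) Fv.
apply/cvg_ballP => e e0; exists n => // m /= nm.
suff -> : (\sum_(0 <= i < m) cylset_content (F i))%E = cylset_content (\bigcup_i F i).
  exact: ballxx.
rewrite /cylset_content sumEFin big_mkord -l_bigsetU//; congr (l _)%:E.
rewrite -bigcup_mkord predeqE => u; split=> [[i _ Fi]|/nP[i im Fi]]; first by exists i.
by exists i => //=; exact: leq_trans im nm.
Qed.

HB.instance Definition _ := isMeasure.Build cylset_display (cylset_strings N) R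
  cylset_content content0 content_ge0 content_semi_sigma_additive.

(** Caratheodory's extension of the content, read as a measure on the Borel sets, which the cylinder
    sets generate. *)
Definition cylset_measure : set (strings N) -> \bar R :=
  measure_extension cylset_content.

Let cylset_measure0 : cylset_measure set0 = 0%E.
Proof. exact: (measure0 (measure_extension cylset_content)). Qed.

Let cylset_measure_ge0 A : (0 <= cylset_measure A)%E.
Proof. exact: (measure_ge0 (measure_extension cylset_content)). Qed.

Let cylset_measure_semi_sigma_additive : semi_sigma_additive cylset_measure.
Proof.
move=> F mF tF mUF.
apply: (@measure_semi_sigma_additive _ _ _ (measure_extension cylset_content)) => //.
- by move=> i; have := mF i; rewrite measurable_cylset.
- by have := mUF; rewrite measurable_cylset.
Qed.

HB.instance Definition _ := isMeasure.Build _ (strings N) R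
  cylset_measure cylset_measure0 cylset_measure_ge0 cylset_measure_semi_sigma_additive.

Lemma cylset_measureE A : cylset A -> cylset_measure A = (l A)%:E.
Proof.
by move=> cA; rewrite /cylset_measure /measure_extension measurable_mu_extE.
Qed.

Hypothesis lT : l setT = 1.

Let cylset_measureT : cylset_measure setT = 1%E.
Proof. by rewrite cylset_measureE ?lT//; exact: cylsetT. Qed.

HB.instance Definition _ := Measure_isProbability.Build _ (strings N) R
  cylset_measure cylset_measureT.

Lemma content_extension : exists mu : probability (strings N) R,
  forall A, cylset A -> mu A = (l A)%:E.
Proof. by exists cylset_measure; exact: cylset_measureE. Qed.

End content_extension.

Section weak_compact.
Context {N : nat} {R : realType}.

(** Along an ultrafilter the mass of each cylinder set converges. The limits are additive on
    cylinder sets, hence extend to a probability, and integrals converge to its integrals because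
    finitely many word masses determine them up to e / 3. *)
Lemma weak_compact : compact [set: weak_probability R N].
Proof.
rewrite compact_ultra => F FU _.
have FF : ProperFilter F by exact: ultra_proper.
pose ev (A : set (strings N)) (nu : weak_probability R N) : R := fine (nu A).
have evl A : exists x : R, cylset A -> ev A @ F --> x.
  have [cA|] := pselect (cylset A); last by exists 0.
  have mA := cylset_measurable cA.
  have FEF : ProperFilter (ev A @ F) by exact: fmap_proper_filter.
  have FE : (ev A @ F) `[0, 1]%classic.
    suff : F [set nu | `[0, 1]%classic (ev A nu)] by [].
    apply: filterS filterT => nu _; rewrite /= in_itv /= fine_ge0//=.
    rewrite -lee_fin fineK; first exact: probability_le1.
    exact: fin_num_measure.
  have [x [_ Fx]] := @segment_compact R 0 1 _ FEF FE.
  (* A cluster point of an ultrafilter is a limit. *)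
  exists x => _ B xB; have [//|nFB] := in_ultra_setVsetC (ev A @^-1` B) FU.
  have [y [nBy By]] := Fx (~` B) B nFB xB.
  by case: nBy.
have {evl}[l lP] := choice evl.
have lE A x : cylset A -> ev A @ F --> x -> l A = x.
  by move=> cA Ax; apply: (cvg_unique _ (lP A cA) Ax).
(* [choice] says nothing of [l] off the cylinder sets; the value 0 there makes the content
   nonnegative on all sets. *)
pose l' A := if `[< cylset A >] then l A else 0.
have l'E A : cylset A -> l' A = l A by move=> cA; rewrite /l' asboolT.
have l'0 A : 0 <= l' A.
  rewrite /l'; case: asboolP => // cA.
  apply: (cvgr_to_ge (lP A cA)); apply: nearW => nu; exact: fine_ge0.
have F1 : l' setT = 1.
  rewrite l'E; last exact: cylsetT.
  apply: lE; first exact: cylsetT.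
  rewrite (_ : ev setT = cst 1); first exact: cvg_cst.
  by apply/funext => nu; rewrite /ev /=; exact: (congr1 fine (probability_setT nu)).
have F0 : l' set0 = 0.
  rewrite l'E; last exact: cylset0.
  apply: lE; first exact: cylset0.
  rewrite (_ : ev set0 = cst 0); first exact: cvg_cst.
  by apply/funext => nu; rewrite /ev /= measure0.
have FU' A B : cylset A -> cylset B -> [disjoint A & B] -> l' (A `|` B) = l' A + l' B.
  move=> cA cB AB; have cAB := cylsetU cA cB; rewrite !l'E//; apply: lE => //.
  rewrite (_ : ev (A `|` B) = ev A \+ ev B).
    by apply: cvgD; exact: lP.
  apply/funext => nu; rewrite /ev /= measureU ?fineD//.
  - by apply: fin_num_measure; exact: cylset_measurable.
  - by apply: fin_num_measure; exact: cylset_measurable.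
  - exact: cylset_measurable.
  - exact: cylset_measurable.
  - exact/disj_set2P.
have [mu muE] := content_extension l'0 F0 FU' F1.
exists (mu : weak_probability R N); split=> //.
apply: weak_cvg => f e fc e0.
have e30 : 0 < e / 3 by rewrite divr_gt0.
have [q fq] := uniform_modulus fc e30.
pose S (nu : weak_probability R N) := \sum_w law nu (pref q) w * f (pad w).
have cw (w : q.-tuple 'I_N.+1) : cylset (pref q @^-1` [set w]).
  exists q => u v uv /= <-; exact/esym/pref_agree.
have Scvg : S @ F --> S mu.
  rewrite /S; apply: cvg_big => [|w _]; first exact: add_continuous.
  apply: cvgM; last exact: cvg_cst.
  rewrite /law muE// l'E//=; exact: lP.
have : F [set nu | `|S mu - S nu| <= e / 3] by move/cvgrPdist_le : Scvg; exact.
apply: filterS => nu /=; rewrite /close_on /=.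
have := Rintegral_modulus nu fc fq; have := Rintegral_modulus mu fc fq.
by rewrite -/(S nu) -/(S mu) !ler_norml; lra.
Qed.

End weak_compact.

(** * Independent blocks *)

Section block_words.
Context {R : realType} {A : finType}.
Implicit Types (F p : seq A -> R) (s : seq A).

Lemma sum_tuple_cat a b F :
  \sum_(i : (a + b).-tuple A) F i =
  \sum_(s : a.-tuple A) \sum_(t : b.-tuple A) F (s ++ t).
Proof.
rewrite pair_big /=.
rewrite (reindex (fun st : a.-tuple A * b.-tuple A => [tuple of st.1 ++ st.2])) //=.
exists (fun i : (a + b).-tuple A => ([tuple tnth i (lshift b k) | k < a],
    [tuple tnth i (rshift a k) | k < b])) => [st _|i _].
  rewrite [st]surjective_pairing.
  by congr pair; apply: eq_from_tnth => k; rewrite tnth_mktuple ?tnth_lshift ?tnth_rshift.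
apply: eq_from_tnth => j; rewrite -(splitK j); case: (fintype.split j) => k /=.
  by rewrite tnth_lshift tnth_mktuple.
by rewrite tnth_rshift tnth_mktuple.
Qed.

Lemma sum_tuple0 F : \sum_(i : 0.-tuple A) F i = F [::].
Proof.
rewrite (big_pred1 [tuple]) // => i; apply/esym/eqP.
exact: tuple0.
Qed.

Variable m : nat.

Fixpoint block_sum F K s : R :=
  if K is K'.+1 then F (take m s) + block_sum F K' (drop m s) else 0.

(** For p a law on words of length m, the density of K independent such words. *)
Fixpoint block_prod p K s : R :=
  if K is K'.+1 then p (take m s) * block_prod p K' (drop m s) else 1.

Variable p : seq A -> R.
Hypothesis p0 : forall s, 0 <= p s.
Hypothesis p1 : \sum_(w : m.-tuple A) p w = 1.

Lemma block_prod_ge0 K s : 0 <= block_prod p K s.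
Proof. by elim: K s => [|K IH] s /=; rewrite ?ler01// mulr_ge0. Qed.

Lemma block_sum_addl F (c : R) K s :
  block_sum (fun w => F w - c) K s = block_sum F K s - K%:R * c.
Proof.
elim: K s => [|K IH] s /=; first by rewrite mul0r subr0.
by rewrite IH -natr1; ring.
Qed.

Lemma sum_blockS K F :
  \sum_(i : (K.+1 * m).-tuple A) F i =
  \sum_(s : m.-tuple A) \sum_(t : (K * m).-tuple A) F (s ++ t).
Proof. exact: (sum_tuple_cat m (K * m)). Qed.

Lemma sum_block_prod K : \sum_(i : (K * m).-tuple A) block_prod p K i = 1.
Proof.
elim: K => [|K IH]; first by rewrite (sum_tuple0 (block_prod p 0)).
rewrite (sum_blockS K (block_prod p K.+1)) -p1; apply: eq_bigr => s _.
under eq_bigr do rewrite /= take_size_cat ?drop_size_cat ?size_tuple//.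
by rewrite -mulr_sumr IH mulr1.
Qed.

Let block_step K (G : seq A -> seq A -> R) F :
  (forall (s : m.-tuple A) t, F (s ++ t) = G s t) ->
  \sum_(i : (K.+1 * m).-tuple A) F i =
  \sum_(s : m.-tuple A) \sum_(t : (K * m).-tuple A) G s t.
Proof.
move=> FG; rewrite sum_blockS; apply: eq_bigr => s _; apply: eq_bigr => t _.
exact: FG.
Qed.

Let takeE (s : m.-tuple A) t : take m (s ++ t) = s.
Proof. by rewrite take_size_cat ?size_tuple. Qed.

Let dropE (s : m.-tuple A) t : drop m (s ++ t) = t.
Proof. by rewrite drop_size_cat ?size_tuple. Qed.

Lemma sum_block_mean K F : \sum_(w : m.-tuple A) p w * F w = 0 ->
  \sum_(i : (K * m).-tuple A) block_prod p K i * block_sum F K i = 0.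
Proof.
move=> pF; elim: K => [|K IH].
  by rewrite (sum_tuple0 (fun s => block_prod p 0 s * block_sum F 0 s)) mulr0.
rewrite (@block_step K (fun s t => block_prod p K t * (p s * F s) +
    p s * (block_prod p K t * block_sum F K t))
  (fun s => block_prod p K.+1 s * block_sum F K.+1 s)); last first.
  by move=> s t; rewrite /= takeE dropE; ring.
under eq_bigr do rewrite big_split/= -mulr_suml sum_block_prod mul1r -mulr_sumr IH mulr0 addr0.
exact: pF.
Qed.

(** Variances of independent centred blocks add up: in the square of the first block plus the
    others, the cross term vanishes by [sum_block_mean]. *)
Lemma sum_block_variance K F : \sum_(w : m.-tuple A) p w * F w = 0 ->
  \sum_(i : (K * m).-tuple A) block_prod p K i * block_sum F K i ^+ 2 =
  K%:R * \sum_(w : m.-tuple A) p w * F w ^+ 2.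
Proof.
move=> pF; elim: K => [|K IH].
  rewrite (sum_tuple0 (fun s => block_prod p 0 s * block_sum F 0 s ^+ 2)).
  by rewrite mul0r /= expr0n mulr0.
rewrite (@block_step K (fun s t => block_prod p K t * (p s * F s ^+ 2) +
    (2 * (p s * F s)) * (block_prod p K t * block_sum F K t) +
    p s * (block_prod p K t * block_sum F K t ^+ 2))
  (fun s => block_prod p K.+1 s * block_sum F K.+1 s ^+ 2)); last first.
  by move=> s t; rewrite /= takeE dropE; ring.
under eq_bigr do rewrite !big_split/= -mulr_suml sum_block_prod mul1r
  -!mulr_sumr IH sum_block_mean// mulr0 addr0.
by rewrite big_split/= -mulr_suml p1 mul1r -natr1 mulrDl mul1r addrC.
Qed.

(* Chebyshev's inequality for i.i.d. blocks of law p. *)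
Lemma block_lln (I : finType) (F : I -> seq A -> R) (c : I -> R) (d : R) :
  (forall i, \sum_(w : m.-tuple A) p w * F i w = c i) -> 0 < d ->
  exists K0, forall K, (K0 <= K)%N -> 1 / 2 <=
    \sum_(s : (K * m).-tuple A |
         [forall i, `|block_sum (F i) K s - K%:R * c i| <= K%:R * d])
      block_prod p K s.
Proof.
move=> pF d0; pose G i w := F i w - c i.
have pG i : \sum_(w : m.-tuple A) p w * G i w = 0.
  by under eq_bigr do rewrite mulrBr; rewrite sumrB pF -mulr_suml p1 mul1r subrr.
(* Summing the variances over all i pays for the union bound. *)
pose V := \sum_i \sum_(w : m.-tuple A) p w * G i w ^+ 2.
have V0 : 0 <= V.
  by rewrite sumr_ge0// => i _; rewrite sumr_ge0// => w _; rewrite mulr_ge0// sqr_ge0.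
have d20 : 0 < d ^+ 2 by rewrite exprn_gt0.
(* Chebyshev bounds the bad mass by V / (K d^2), at most 1/2 once K >= 2 V / d^2; the successor
   below keeps K positive. *)
have [K0 K0V] : exists K0 : nat, 2 * V / d ^+ 2 < K0%:R.
  by have := archi_boundP (divr_ge0 (mulr_ge0 (ler0n _ 2) V0) (ltW d20)); eexists; eassumption.
exists K0.+1 => K K0K.
have KR : (0 : R) < K%:R by rewrite ltr0n (leq_trans _ K0K).
have KV : V <= K%:R * d ^+ 2 / 2.
  rewrite ler_pdivlMr// mulrC -ler_pdivrMr//.
  by rewrite (le_trans (ltW K0V))// ler_nat ltnW.
pose Good (s : seq A) := [forall i, `|block_sum (F i) K s - K%:R * c i| <= K%:R * d].
have Kd : 0 < (K%:R * d) ^+ 2 by rewrite exprn_gt0// mulr_gt0.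
have bad : \sum_(s : (K * m).-tuple A | ~~ Good s) block_prod p K s <= 1 / 2.
  apply: (@le_trans _ _ (\sum_(s : (K * m).-tuple A) \sum_i
      block_prod p K s * block_sum (G i) K s ^+ 2 / (K%:R * d) ^+ 2)).
    rewrite big_mkcond/=; apply: ler_sum => s _.
    have G0 i : 0 <= block_prod p K s * block_sum (G i) K s ^+ 2 / (K%:R * d) ^+ 2.
      by rewrite divr_ge0 ?(ltW Kd)// mulr_ge0 ?sqr_ge0// block_prod_ge0.
    case: ifP => [|_]; last by rewrite sumr_ge0.
    move=> /forallPn[i +]; rewrite -ltNge => Fi.
    rewrite (bigD1 i)//= ler_wpDr ?sumr_ge0// ler_pdivlMr// ler_wpM2l ?block_prod_ge0//.
    rewrite -(real_normK (num_real (block_sum _ _ _))) ler_pXn2r ?nnegrE//.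
      by rewrite block_sum_addl ltW.
    by rewrite mulr_ge0// ltW.
  rewrite exchange_big/=.
  under eq_bigr do rewrite -mulr_suml sum_block_variance//.
  rewrite -mulr_suml -mulr_sumr -/V ler_pdivrMr// exprMn.
  rewrite (_ : 1 / 2 * (K%:R ^+ 2 * d ^+ 2) = K%:R * (K%:R * d ^+ 2 / 2)).
    by rewrite ler_pM2l.
  by field.
have := sum_block_prod K; rewrite (bigID (fun s : (K * m).-tuple A => Good s))/=.
by move: bad; rewrite /Good; lra.
Qed.

End block_words.

(** * Birkhoff sums *)

Section birkhoff.
Context {N : nat} {R : realType}.
Implicit Types (u v : strings N) (f : strings N -> R).

Lemma birkhoff_sumD f a b u :
  birkhoff_sum f (a + b) u = birkhoff_sum f a u + birkhoff_sum f b (iter a shift u).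
Proof.
rewrite /birkhoff_sum big_split_ord/=; congr (_ + _).
by apply: eq_bigr => k _; rewrite addnC iterD.
Qed.

Lemma birkhoff_sumS f n u :
  birkhoff_sum f n.+1 u = birkhoff_sum f n u + f (iter n shift u).
Proof. by rewrite /birkhoff_sum big_ord_recr. Qed.

Lemma birkhoff_sum_le f M n u : (forall v, `|f v| <= M) ->
  `|birkhoff_sum f n u| <= n%:R * M.
Proof.
move=> fM; apply: le_trans (ler_norm_sum _ _ _) _.
apply: (@le_trans _ _ (\sum_(k < n) M)); first exact: ler_sum.
by rewrite sumr_const card_ord mulr_natl.
Qed.

(* Only the last q summands see letters beyond the first m ones. *)
Lemma birkhoff_sum_agree f q e M m u v : modulus f q e -> 0 <= e ->
  (forall w, `|f w| <= M) -> agree m u v ->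
  `|birkhoff_sum f m u - birkhoff_sum f m v| <= m%:R * e + q%:R * (2 * M).
Proof.
move=> fq e0 fM uv; have M0 : 0 <= M := le_trans (normr_ge0 _) (fM u).
rewrite /birkhoff_sum -sumrB; apply: le_trans (ler_norm_sum _ _ _) _.
apply: (@le_trans _ _ (\sum_(k < m) (e + (m < k + q)%N%:R * (2 * M)))).
  apply: ler_sum => k _; have [mkq|kqm] := ltnP m (k + q).
    rewrite mul1r (le_trans (ler_normB _ _))//.
    have := fM (iter k shift u); have := fM (iter k shift v); lra.
  rewrite mul0r addr0; apply: fq; apply: agree_iter_shift.
  by apply: agree_le uv; rewrite addnC.
rewrite big_split/= sumr_const card_ord -[e *+ m]mulr_natl lerD2l -mulr_suml.
rewrite ler_wpM2r ?mulr_ge0// -natr_sum ler_nat.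
rewrite (reindex_inj rev_ord_inj)/=.
apply: (@leq_trans (\sum_(k < m) (k < q))).
  apply: leq_sum => k _; have := ltn_ord k; case: (ltnP k q) => kq km.
    exact: leq_b1.
  by rewrite (_ : (m < _)%N = false)//=; lia.
have : (\sum_(k < m) (k < q) <= minn m q)%N.
  elim: (m) => [|l IH]; first by rewrite big_ord0.
  rewrite big_ord_recr/=; move: IH; set S := (\sum_(_ < _) _)%N; case: (ltnP l q) => /=; lia.
by move/leq_trans; apply; exact: geq_minr.
Qed.

Lemma comp_iter_shift_continuous f j : continuous f ->
  continuous (fun u => f (iter j shift u)).
Proof.
move=> fc; apply: modulus_continuous => e e0; have [q fq] := uniform_modulus fc e0.
by exists (q + j)%N => u v uv; apply: fq; exact: agree_iter_shift.
Qed.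

Lemma birkhoff_sum_continuous f n : continuous f -> continuous (birkhoff_sum f n).
Proof.
move=> fc; elim: n => [|n IH].
  rewrite (_ : birkhoff_sum f 0 = cst 0); first exact: cst_continuous.
  by apply/funext => u; rewrite /birkhoff_sum big_ord0.
rewrite (_ : birkhoff_sum f n.+1 = birkhoff_sum f n \+ (fun u => f (iter n shift u))).
  by move=> u; exact: (cvgD (IH u) (@comp_iter_shift_continuous f n fc u)).
by apply/funext => u; rewrite birkhoff_sumS.
Qed.

Variable mu : probability (strings N) R.
Hypothesis inv : invariant mu.

Lemma invariant_Rintegral_shift f j : continuous f ->
  \int[mu]_u f (iter j shift u) = \int[mu]_u f u.
Proof.
move=> fc; apply/eqP; rewrite -subr_eq0 -normr_le0; apply/ler_addgt0Pl => e e0.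
have e20 : 0 < e / 2 by rewrite divr_gt0.
have [q fq] := uniform_modulus fc e20.
have mZ : discrete_rv (@pref N q) by exact: pref_discrete_rv.
have h1 := Rintegral_modulus mu fc fq.
have h2 : `|\int[mu]_u f (iter j shift u) -
    \sum_w law mu (pref q \o iter j shift) w * f (pad w)| <= e / 2.
  apply: (@Rintegral_approx _ _ _ _ _ (fun w : q.-tuple _ => f (pad w))).
  - exact: comp_iter_shift_continuous.
  - exact: discrete_rv_iter_shift.
  - by move=> u; apply: fq; apply: agree_sym; exact: pad_pref.
rewrite law_iter_shift// in h2.
by move: h1 h2; rewrite !ler_norml; lra.
Qed.

Lemma invariant_Rintegral_birkhoff f n : continuous f ->
  \int[mu]_u birkhoff_sum f n u = n%:R * \int[mu]_u f u.
Proof.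
move=> fc; elim: n => [|n IH].
  rewrite mul0r (_ : birkhoff_sum f 0 = cst 0).
    by rewrite Rintegral_cst// mul0r.
  by apply/funext => u; rewrite /birkhoff_sum big_ord0.
under eq_Rintegral do rewrite birkhoff_sumS.
have ci (g : strings N -> R) : continuous g -> mu.-integrable setT (EFin \o g).
  exact: continuous_integrable.
rewrite RintegralD//; last 2 first.
- by apply: ci; exact: birkhoff_sum_continuous.
- by apply: ci; exact: comp_iter_shift_continuous.
by rewrite IH invariant_Rintegral_shift// -natr1 mulrDl mul1r.
Qed.

(** Each block is evaluated at its own padding instead of its true continuation;
    [birkhoff_sum_agree] bounds what this changes per block. *)
Lemma block_sum_birkhoff f q e M m K (s : seq 'I_N.+1) u :
  modulus f q e -> 0 <= e -> (forall w, `|f w| <= M) ->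
  (size s = K * m)%N -> (forall j, (j < K * m)%N -> u j = nth ord0 s j) ->
  `|birkhoff_sum f (K * m) u -
    block_sum m (fun w => birkhoff_sum f m (pad w)) K s| <=
  K%:R * (m%:R * e + q%:R * (2 * M)).
Proof.
move=> fq e0 fM; elim: K s u => [|K IH] s u /=.
  by move=> _ _; rewrite mul0r /birkhoff_sum big_ord0 subr0 normr0.
move=> sK us; rewrite mulSn birkhoff_sumD -natr1 mulrDl mul1r.
have h1 : `|birkhoff_sum f m u - birkhoff_sum f m (pad (take m s))| <=
    m%:R * e + q%:R * (2 * M).
  apply: birkhoff_sum_agree => // j jm; rewrite us ?mulSn ?ltn_addr//.
  by rewrite /pad nth_take.
have h2 := IH (drop m s) (iter m shift u).
have {}h2 := h2 (ltac:(by rewrite size_drop sK mulSn addKn)).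
have {}h2 := h2 (fun j jK => ltac:(by rewrite iter_shiftE us ?nth_drop ?mulSn
  ?[(m + j)%N]addnC// addnC ltn_add2l)).
by move: h1 h2; rewrite !ler_norml; lra.
Qed.

(** The 6 counts multiples of n e, for n = K m + r: two for passing from the Birkhoff sum to blocks,
    one for the blocks against their mean, two for that mean against m times the integral, one for
    the r leftover letters and r times the integral. *)
Lemma birkhoff_block_close f q e M m K r (s : seq 'I_N.+1) u :
  continuous f -> modulus f q e -> 0 <= e -> (forall w, `|f w| <= M) ->
  (r <= m)%N -> (size s = K * m)%N ->
  (forall j, (j < K * m)%N -> u j = nth ord0 s j) ->
  q%:R * (2 * M) <= m%:R * e -> 2 * (m%:R * M) <= (K * m + r)%:R * e ->
  `|block_sum m (fun w => birkhoff_sum f m (pad w)) K s - K%:R *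
      \sum_w law mu (@pref N m) w * birkhoff_sum f m (pad w)| <= K%:R * (m%:R * e) ->
  `|birkhoff_sum f (K * m + r) u - (K * m + r)%:R * \int[mu]_v f v|
    <= 6 * ((K * m + r)%:R * e).
Proof.
move=> fc fq e0 fM rm sK us qM mM bc.
have M0 : 0 <= M := le_trans (normr_ge0 _) (fM u).
set I := \int[mu]_v f v in bc *.
have IM : `|I| <= M.
  have := @Rintegral_approx _ _ mu _ (@pref N 0) (fun=> 0) f M fc
    (@pref_discrete_rv N 0) (fun w => ltac:(by rewrite subr0)).
  by under eq_bigr do rewrite mulr0; rewrite big1// subr0.
set c := \sum_w _ in bc; set S := block_sum _ _ _ _ in bc.
have h1 : `|birkhoff_sum f (K * m) u - S| <= K%:R * (m%:R * e + q%:R * (2 * M)).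
  exact: block_sum_birkhoff.
have h2 : `|m%:R * I - c| <= m%:R * e + q%:R * (2 * M).
  rewrite -invariant_Rintegral_birkhoff//; apply: Rintegral_modulus.
    exact: birkhoff_sum_continuous.
  by move=> v w; exact: birkhoff_sum_agree.
have h3 : K%:R * `|m%:R * I - c| <= K%:R * (m%:R * e + q%:R * (2 * M)).
  by rewrite ler_wpM2l.
have h4 : K%:R * (m%:R * e + q%:R * (2 * M)) <= K%:R * (m%:R * e + m%:R * e).
  by rewrite ler_wpM2l// lerD2l.
have h5 := birkhoff_sum_le r (iter (K * m) shift u) fM.
have h6 : r%:R * M <= m%:R * M by rewrite ler_wpM2r// ler_nat.
have h7 : r%:R * `|I| <= r%:R * M by rewrite ler_wpM2l.
have h8 : K%:R * (m%:R * e) <= (K * m + r)%:R * e.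
  by rewrite mulrA -natrM ler_wpM2r// ler_nat leq_addr.
rewrite birkhoff_sumD.
rewrite (_ : _ - _ = (birkhoff_sum f (K * m) u - S) + (S - K%:R * c) -
    K%:R * (m%:R * I - c) + birkhoff_sum f r (iter (K * m) shift u) - r%:R * I); last first.
  by rewrite natrD natrM; ring.
have n1 : `|K%:R * (m%:R * I - c)| = K%:R * `|m%:R * I - c|.
  by rewrite normrM ger0_norm.
have n2 : `|r%:R * I| = r%:R * `|I| by rewrite normrM ger0_norm.
rewrite (le_trans (ler_normB _ _))// n2 (le_trans (lerD (ler_normD _ _) (lexx _)))//.
have := ler_normB ((birkhoff_sum f (K * m) u - S) + (S - K%:R * c)) (K%:R * (m%:R * I - c)).
have := ler_normD (birkhoff_sum f (K * m) u - S) (S - K%:R * c).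
rewrite n1; lra.
Qed.

(** A positive product of nonnegative factors has positive factors; a null one would spoil the
    formula, as [ln] is 0 at 0. *)
Lemma block_prod_expR (A : finType) m (p : seq A -> R) K s : (forall w, 0 <= p w) ->
  0 < block_prod m p K s -> block_prod m p K s = expR (block_sum m (fun w => ln (p w)) K s).
Proof.
move=> p0; elim: K s => [|K IH] s /=; first by rewrite expR0.
move=> pp; have p1 : 0 < p (take m s).
  rewrite lt_neqAle p0 andbT eq_sym; apply/negP => /eqP pE.
  by move: pp; rewrite pE mul0r ltxx.
by rewrite expRD lnK// -IH// -(pmulr_rgt0 _ p1).
Qed.

End birkhoff.

(** * Lower bound *)

Section lower_bound.
Context {R : realType} {N : nat} {X : metricType R}.

Lemma neighborhoodP (C : set X) (r : R) x :
  neighborhood C r x <-> exists2 y, C y & ball x r y.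
Proof.
rewrite /neighborhood /=; split=> [/ereal_inf_lt[_ [y Cy <-]]|[y Cy]].
  by rewrite lte_fin => xy; exists y => //; rewrite ballEmdist.
rewrite ballEmdist/= => xy; apply: le_lt_trans (_ : (_ <= (mdist x y)%:E)%E) _.
  by apply: ereal_inf_lbound; exists y.
by rewrite lte_fin.
Qed.

Lemma closure_ball_neighborhood (C : set X) (r : R) x y : closure C x ->
  ball x (r / 2) y -> neighborhood C r y.
Proof.
move=> Cx xy; have [r0|r0] := ltP 0 r; last first.
  move: xy; rewrite ballEmdist/= ltNge (le_trans _ (mdist_ge0 _ _))//.
  by rewrite ler_pdivrMr// mul0r.
have r20 : 0 < r / 2 by rewrite divr_gt0.
have [z [Cz xz]] := Cx _ (nbhsx_ballx x _ r20).
by apply/neighborhoodP; exists z => //; apply: (@ball_split _ _ x) => //; exact: ball_sym.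
Qed.

Variables (U : weak_probability R N -> X) (U_continuous : continuous U).
Variables (phi : strings N -> R) (phi_continuous : continuous phi).

Lemma partition_function_geP (C : set X) n (G : seq 'I_N.+1 -> bool) (c : R) :
  (forall (i : n.-tuple 'I_N.+1) u, G i -> cylinder i u ->
     C (U (empirical n u)) /\ c <= birkhoff_sum phi n u) ->
  ((\sum_(i : n.-tuple 'I_N.+1 | G i) expR c)%:E <= partition_function U C phi n)%E.
Proof.
move=> GP; rewrite /partition_function -sumEFin.
rewrite [leRHS]big_mkcond [leLHS]big_mkcond /=; apply: lee_sum => i _.
have sup0 : (0 <= ereal_sup [set (expR (birkhoff_sum phi n u))%:E | u in cylinder i])%E.
  apply: le_trans (_ : ((expR (birkhoff_sum phi n (pad i)))%:E <= _)%E).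
    by rewrite lee_fin expR_ge0.
  by apply: ereal_sup_ubound; exists (pad i) => //; exact: cylinder_pad.
case: ifP => [Gi|_]; last by case: ifP.
rewrite ifT; last first.
  by apply/asboolP => _ [u iu <-]; exact: (GP i u Gi iu).1.
apply: le_trans (_ : ((expR (birkhoff_sum phi n (pad i)))%:E <= _)%E).
  by rewrite lee_fin ler_expR; exact: (GP i _ Gi (cylinder_pad i)).2.
by apply: ereal_sup_ubound; exists (pad i) => //; exact: cylinder_pad.
Qed.

Variable mu : probability (strings N) R.
Hypothesis inv : invariant mu.

(** Extended to all sequences, with value 0 off length m, to be fed to [block_prod]. *)
Definition word_law m (s : seq 'I_N.+1) : R := law mu (fun u => tval (pref m u)) s.

Lemma word_lawE m (w : m.-tuple 'I_N.+1) : word_law m w = law mu (pref m) w.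
Proof.
rewrite /word_law /law (_ : _ @^-1` _ = pref m @^-1` [set w])//.
rewrite predeqE => u; split=> h; first exact: (val_inj h).
exact: (congr1 val h).
Qed.

Lemma word_law_ge0 m s : 0 <= word_law m s.
Proof. exact: law_ge0. Qed.

Lemma sum_word_law m : \sum_(w : m.-tuple 'I_N.+1) word_law m w = 1.
Proof.
under eq_bigr do rewrite word_lawE; apply: sum_law; exact: pref_discrete_rv.
Qed.

(* Under the law of K independent words of length m distributed as under mu, the
   words counted here have probability at least 1/2, and each of them has
   probability at most exp(- K (H_m - e)). *)
Lemma count_block_words m (k : nat) (g : 'I_k -> strings N -> R) (e : R) :
  (0 < m)%N -> 0 < e ->
  exists K0, forall K r, (K0 <= K)%N ->
  expR (K%:R * (word_entropy mu m - e)) / 2 <=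
  \sum_(i : (K * m + r).-tuple 'I_N.+1 | [forall j,
     `|block_sum m (fun w => birkhoff_sum (g j) m (pad w)) K (take (K * m) i) - K%:R *
      \sum_w law mu (@pref N m) w * birkhoff_sum (g j) m (pad w)| <= K%:R * e]) 1.
Proof.
move=> m0 e0.
(* The slot [None] carries the logarithm of the word's own probability, with mean - H_m, so that one
   law of large numbers yields the block averages and the entropy together. *)
pose F (o : option 'I_k) (w : seq 'I_N.+1) : R :=
  if o is Some j then birkhoff_sum (g j) m (pad w) else ln (word_law m w).
pose c o := \sum_(w : m.-tuple 'I_N.+1) word_law m w * F o w.
have [K0 K0P] := block_lln (word_law_ge0 m) (sum_word_law m) (fun o => erefl (c o)) e0.
exists K0 => K r /K0P {K0P}.
pose GoodF (s : seq 'I_N.+1) :=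
  [forall o, `|block_sum m (F o) K s - K%:R * c o| <= K%:R * e].
pose Good (s : seq 'I_N.+1) :=
  [forall j, `|block_sum m (fun w => birkhoff_sum (g j) m (pad w)) K s - K%:R *
      \sum_w law mu (@pref N m) w * birkhoff_sum (g j) m (pad w)| <= K%:R * e].
rewrite -/(Good _) => half.
have GoodFP s : GoodF s -> Good s.
  move=> /forallP GF; apply/forallP => j; have := GF (Some j).
  by rewrite /c; under eq_bigr do rewrite word_lawE.
have cN : c None = - word_entropy mu m.
  by rewrite /c /word_entropy /law_entropy opprK; under eq_bigr do rewrite /= word_lawE.
have prod_le s : GoodF s ->
    block_prod m (word_law m) K s * expR (K%:R * (word_entropy mu m - e)) <= 1.
  move=> /forallP/(_ None); rewrite cN.
  have := block_prod_ge0 m (word_law_ge0 m) K s; rewrite le_eqVlt => /predU1P[<- _|].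
    by rewrite mul0r.
  move=> /(block_prod_expR (word_law_ge0 m)) -> /=.
  rewrite ler_norml => /andP[_ H]; rewrite -expRD expR_le1.
  have {}H : block_sum m (fun w => ln (word_law m w)) K s - K%:R * - word_entropy mu m
    <= K%:R * e := H.
  by lra.
have -> : \sum_(i : (K * m + r).-tuple 'I_N.+1 | Good (take (K * m) i)) (1 : R) =
    \sum_(s : (K * m).-tuple 'I_N.+1 | Good s) \sum_(t : r.-tuple 'I_N.+1) 1.
  rewrite big_mkcond (sum_tuple_cat (K * m) r (fun i => if Good (take (K * m) i) then 1 else 0)).
  rewrite [RHS]big_mkcond /=; apply: eq_bigr => s _.
  under eq_bigr do rewrite take_size_cat ?size_tuple//.
  by case: ifP => // _; rewrite big1.
apply: (@le_trans _ _ (\sum_(s : (K * m).-tuple 'I_N.+1 | GoodF s)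
    block_prod m (word_law m) K s * expR (K%:R * (word_entropy mu m - e)))).
  rewrite -mulr_suml mulrC ler_wpM2r ?expR_ge0//.
  by move: half; rewrite mul1r.
(* The r tail letters are free; counting at least one tail suffices. *)
apply: (@le_trans _ _ (\sum_(s : (K * m).-tuple 'I_N.+1 | GoodF s)
    \sum_(t : r.-tuple 'I_N.+1) 1)).
  apply: ler_sum => s Gs; apply: le_trans (prod_le _ Gs) _.
  by rewrite sumr_const ler1n; apply/card_gt0P; exists [tuple of nseq r ord0].
rewrite [leRHS]big_mkcond [leLHS]big_mkcond /=; apply: ler_sum => s _.
case: ifP => [/GoodFP -> //|_].
by case: ifP => // _; rewrite sumr_ge0.
Qed.

(** The bound of H_m / m by h is asked for every m because m is chosen late: after the weak
    neighbourhood, the tolerance [E] and the moduli of the test functions. *)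
Lemma partition_function_ge (C : set X) (h t r : R) :
  closure C (U mu) -> (forall m, (0 < m)%N -> h <= m%:R^-1 * word_entropy mu m) ->
  t < h + \int[mu]_u phi u -> 0 < r ->
  \forall n \near \oo,
    ((expR (n%:R * t))%:E <= partition_function U (neighborhood C r) phi n)%E.
Proof.
move=> CU hw th r0; pose I := \int[mu]_u phi u; pose d := h + I - t.
have d0 : 0 < d by rewrite subr_gt0.
have /weak_nbhs[fs [e e0 [fsc fsU]]] :
    nbhs (mu : weak_probability R N) (U @^-1` neighborhood C r).
  have r20 : 0 < r / 2 by rewrite divr_gt0.
  have : nbhs (mu : weak_probability R N) (U @^-1` ball (U mu) (r / 2)).
    by have := @U_continuous mu _ (nbhsx_ballx (U mu) _ r20).
  apply: (@filterS _ (nbhs (mu : weak_probability R N))) => nu.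
  exact: closure_ball_neighborhood.
(* [phi] joins the test functions, so that the same words have both their empirical measure and
   their weight under control. *)
pose k := size (phi :: fs).
pose g (j : 'I_k) := nth phi (phi :: fs) j.
have gc j : continuous (g j).
  have : g j \in phi :: fs by exact: mem_nth.
  by rewrite inE => /predU1P[->//|/fsc].
(* Six times [E] fits the neighbourhood, by [birkhoff_block_close]. In the exponent the loss is 6 n
   E for [phi] and at most n E for the entropy, together at most 7/16 of n d; boundary terms take
   half of n d. *)
pose E := Num.min (e / 6) (d / 16).
have E0 : 0 < E by rewrite lt_min !divr_gt0.
have /choice[q gq] j : exists q, modulus (g j) q E by exact: uniform_modulus.
have /choice[M gM] j : exists M, forall u, `|g j u| <= M.
  by have [M _ gM] := continuous_bounded (gc j); exists M.
have M0 j : 0 <= M j := le_trans (normr_ge0 _) (gM j point).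
pose B := \sum_j (q j)%:R * (2 * M j).
have qB j : (q j)%:R * (2 * M j) <= B.
  by rewrite /B (bigD1 j)//= lerDl sumr_ge0// => i _; rewrite !mulr_ge0.
(* Blocks so long that the influence of letters beyond their end costs at most [E] per letter, for
   all test functions at once. *)
have [m m0 mB] : exists2 m : nat, (0 < m)%N & B <= m%:R * E.
  have B0 : 0 <= B by rewrite sumr_ge0// => i _; rewrite !mulr_ge0.
  exists (Num.bound (B / E)).+1 => //; rewrite -ler_pdivrMr//.
  by rewrite (le_trans (ltW (archi_boundP (divr_ge0 B0 (ltW E0)))))// ler_nat.
have mR : (0 : R) < m%:R by rewrite ltr0n.
have mE : 0 < m%:R * E by rewrite mulr_gt0.
have [K0 K0P] := count_block_words g m0 mE.
near=> n.
have K0n : (K0 <= n %/ m)%N.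
  by rewrite leq_divRL//; near: n; exists (K0 * m)%N.
pose K := (n %/ m)%N; pose r' := (n %% m)%N.
have nE : n = (K * m + r')%N by exact: divn_eq.
have rm : (r' < m)%N by exact: ltn_pmod.
have nM j : 2 * (m%:R * M j) <= n%:R * E.
  apply: (@le_trans _ _ (\sum_j 2 * (m%:R * M j))).
    by rewrite (bigD1 j)//= lerDl sumr_ge0// => i _; rewrite !mulr_ge0.
  by rewrite [leRHS]mulrC -ler_pdivrMl//; near: n; exact: nbhs_infty_ger.
have nd : m%:R * `|h| + ln 2 <= n%:R * (d / 2).
  by rewrite [leRHS]mulrC -ler_pdivrMl ?divr_gt0//; near: n; exact: nbhs_infty_ger.
have n0 : (0 < n)%N by near: n; exists 1%N.
have nR : (0 : R) < n%:R by rewrite ltr0n.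
pose Good (s : seq 'I_N.+1) := [forall j,
     `|block_sum m (fun w => birkhoff_sum (g j) m (pad w)) K (take (K * m) s) - K%:R *
      \sum_w law mu (@pref N m) w * birkhoff_sum (g j) m (pad w)| <= K%:R * (m%:R * E)].
have close (i : n.-tuple 'I_N.+1) u j : Good i -> cylinder i u ->
    `|birkhoff_sum (g j) n u - n%:R * \int[mu]_v g j v| <= 6 * (n%:R * E).
  move=> /forallP/(_ j) Gj iu; rewrite {1 2 3}nE.
  apply: (birkhoff_block_close inv (gc j) (gq j) (ltW E0) (gM j) (ltnW rm) _ _ _ _ Gj).
  - rewrite size_take size_tuple {2}nE; have := leq_addr r' (K * m); rewrite -nE.
    by case: ltngtP => //= _ _; exact: esym.
  - move=> l lK; rewrite nth_take//.
    have ln : (l < n)%N by rewrite nE ltn_addr.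
    by rewrite -(tnth_nth _ _ (Ordinal ln)) -iu.
  - exact: le_trans (qB j) mB.
  - by rewrite -nE.
have E6 : 6 * E <= e.
  have : E <= e / 6 by rewrite ge_min lexx.
  by lra.
have Ed : E <= d / 16 by rewrite ge_min lexx orbT.
apply: (@le_trans _ _ (\sum_(i : n.-tuple 'I_N.+1 | Good i)
    expR (n%:R * I - 6 * (n%:R * E)))%:E); last first.
  apply: partition_function_geP => i u Gi iu; split.
    apply: fsU => f ffs; rewrite /close_on /= Rintegral_empirical//; last exact: fsc.
    have fk : (index f (phi :: fs) < k)%N by rewrite index_mem inE ffs orbT.
    have := close i u (Ordinal fk) Gi iu.
    have -> : g (Ordinal fk) = f by rewrite /g nth_index// inE ffs orbT.
    move=> H; rewrite (_ : _ - _ = n%:R^-1 * (birkhoff_sum f n u - n%:R * \int[mu]_v f v)).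
      rewrite normrM ger0_norm ?invr_ge0 ?(ltW nR)// ler_pdivrMl//.
      by apply: le_trans H _; rewrite mulrCA ler_pM2l.
    by rewrite mulrBr mulKf ?gt_eqF.
  have := close i u ord0 Gi iu; rewrite /g /= ler_norml -/I; lra.
rewrite lee_fin; have := K0P K r' K0n; rewrite -nE => H.
have -> : \sum_(i : n.-tuple 'I_N.+1 | Good i) expR (n%:R * I - 6 * (n%:R * E)) =
    (\sum_(i : n.-tuple 'I_N.+1 | Good i) 1) * expR (n%:R * I - 6 * (n%:R * E)).
  by rewrite mulr_suml; apply: eq_bigr => i _; rewrite mul1r.
apply: (@le_trans _ _ (expR (K%:R * (word_entropy mu m - m%:R * E)) / 2 *
    expR (n%:R * I - 6 * (n%:R * E)))); last by rewrite ler_wpM2r// expR_ge0.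
rewrite mulrAC -expRD ler_pdivlMr// -[X in _ * X]lnK ?posrE// -expRD ler_expR.
have mh : m%:R * h <= word_entropy mu m by have := hw m m0; rewrite ler_pdivlMl.
have Kmh : K%:R * (m%:R * h) <= K%:R * word_entropy mu m by rewrite ler_wpM2l.
have nKR : n%:R = K%:R * m%:R + r'%:R :> R by rewrite {1}nE natrD natrM.
have rh : r'%:R * h <= m%:R * `|h|.
  apply: (@le_trans _ _ (r'%:R * `|h|)); first by rewrite ler_wpM2l// ler_norm.
  by rewrite ler_wpM2r// ler_nat ltnW.
have KE : K%:R * (m%:R * E) <= n%:R * E.
  by rewrite mulrA ler_wpM2r ?(ltW E0)// nKR lerDl.
have nEd : n%:R * E <= n%:R * (d / 16) by rewrite ler_pM2l.
have nh : n%:R * h = K%:R * (m%:R * h) + r'%:R * h by rewrite nKR; ring.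
have tE : t = h + I - d by rewrite /d; ring.
rewrite tE.
have nd0 : 0 <= n%:R * d by rewrite mulr_ge0// ltW.
move: Kmh rh KE nEd nd nh nd0; lra.
Unshelve. all: by end_near. Qed.

End lower_bound.

(** * Sliding windows *)

(** The tangent to exp at the mean [a] lies below the graph, and the deviations from [a] sum to
    0. *)
Lemma jensen_expR (R : realType) m (x : 'I_m -> R) : (0 < m)%N ->
  expR ((\sum_j x j) / m%:R) <= (\sum_j expR (x j)) / m%:R.
Proof.
move=> m0; have mR : (0 : R) < m%:R by rewrite ltr0n.
set a := (\sum_j x j) / m%:R; rewrite ler_pdivlMr//.
apply: (@le_trans _ _ (\sum_j expR a * (1 + (x j - a)))).
  rewrite -mulr_sumr ler_pM2l ?expR_gt0// big_split/= sumrB !sumr_const card_ord.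
  by rewrite -[a *+ m]mulr_natr mulfVK ?gt_eqF// subrr addr0.
apply: ler_sum => j _; rewrite -[x j in leRHS](subrK a) expRD mulrC.
by rewrite ler_pM2r ?expR_gt0// expR_ge1Dx.
Qed.

Section windows.
Context {R : realType} {A : finType}.
Variables (m : nat) (q : seq A -> R).
Hypothesis m0 : (0 < m)%N.
Hypothesis q_gt0 : forall s, 0 < q s.
Hypothesis q1 : \sum_(w : m.-tuple A) q w = 1.

Definition blocks_ln (s : seq A) : R := block_sum m (fun w => ln (q w)) (size s %/ m) s.

Lemma blocks_lnS s : (m <= size s)%N ->
  blocks_ln s = ln (q (take m s)) + blocks_ln (drop m s).
Proof.
move=> ms; rewrite /blocks_ln size_drop -{1}(subnK ms) divnDr ?dvdnn// divnn m0 addn1.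
by [].
Qed.

Lemma blocks_ln_small s : (size s < m)%N -> blocks_ln s = 0.
Proof. by move=> sm; rewrite /blocks_ln divn_small. Qed.

(* The m offsets together run through all windows of length m once: unlike
   blocks_ln, windows_ln is a Birkhoff sum up to boundary terms. *)
Definition windows_ln (s : seq A) : R := \sum_(j < m) blocks_ln (drop j s).

Lemma windows_ln_small s : (size s < m)%N -> windows_ln s = 0.
Proof.
move=> sm; rewrite /windows_ln big1// => j _; apply: blocks_ln_small.
by rewrite size_drop (leq_ltn_trans (leq_subr _ _)).
Qed.

(** Offset 0 of x :: s is the first window followed by offset m - 1 of s; every other offset j + 1
    is offset j of s. *)
Lemma windows_ln_cons x s : (m <= size (x :: s))%N ->
  windows_ln (x :: s) = ln (q (take m (x :: s))) + windows_ln s.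
Proof.
rewrite /windows_ln => ms; have /= := blocks_lnS ms.
have [m' mE] : exists m', m = m'.+1 by exists m.-1; rewrite prednK.
move: (blocks_ln) => bl; rewrite mE /= => H.
by rewrite big_ord_recl [in RHS]big_ord_recr/= H addrA addrAC -addrA.
Qed.

Lemma block_prod_gt0 K s : 0 < block_prod m q K s.
Proof. by elim: K s => [|K IH] s /=; rewrite ?ltr01// mulr_gt0. Qed.

Lemma block_prod_cat K s t : (size s = K * m)%N ->
  block_prod m q K (s ++ t) = block_prod m q K s.
Proof.
elim: K s => [//|K IH] s sK /=.
have ms : (m <= size s)%N by rewrite sK mulSn leq_addr.
rewrite takel_cat//; congr (_ * _).
rewrite drop_cat; case: ltngtP ms => // [ms _|ms _].
  by apply: IH; rewrite size_drop sK mulSn addKn.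
by have -> : K = 0%N by nia.
Qed.

Lemma expR_blocks_ln s : expR (blocks_ln s) = block_prod m q (size s %/ m) s.
Proof.
by rewrite (block_prod_expR (fun w => ltW (q_gt0 w)))//; exact: block_prod_gt0.
Qed.

Lemma card_gt0_of_sum : (1 <= #|A|)%N.
Proof.
rewrite lt0n; apply/negP => /eqP A0; move: q1; rewrite big1.
  by move/eqP; rewrite eq_sym oner_eq0.
by move=> w _; move: (card_tuple m A); rewrite A0 exp0n// => /card0_eq/(_ w).
Qed.

(** Over full blocks the products of q sum to 1; fewer than m letters are left over, and these are
    free. *)
Lemma sum_expR_blocks_ln n :
  \sum_(i : n.-tuple A) expR (blocks_ln i) <= (#|A| ^ m)%:R.
Proof.
under eq_bigr do rewrite expR_blocks_ln size_tuple.
pose K := (n %/ m)%N; pose r := (n %% m)%N; rewrite -/K.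
have nE : n = (K * m + r)%N by exact: divn_eq.
move: K r nE (ltn_pmod n m0 : (r < m)%N) => K r -> rm.
rewrite (sum_tuple_cat (K * m) r (fun i => block_prod m q K i)).
under eq_bigr => s _ do under eq_bigr do rewrite block_prod_cat ?size_tuple//.
under eq_bigr do rewrite sumr_const card_tuple -[_ *+ _]mulr_natr.
rewrite -mulr_suml sum_block_prod// mul1r ler_nat.
by rewrite leq_pexp2l// ?card_gt0_of_sum// ltnW.
Qed.

(** The skipped letters, at most m, are free as well, hence a second factor |A|^m. In a word shorter
    than j all letters are free. *)
Lemma sum_expR_blocks_ln_drop n j : (j <= m)%N ->
  \sum_(i : n.-tuple A) expR (blocks_ln (drop j i)) <= (#|A| ^ (2 * m))%:R.
Proof.
move=> jm; have [jn|nj] := leqP j n; last first.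
  have small (i : n.-tuple A) : expR (blocks_ln (drop j i)) = 1.
    by rewrite blocks_ln_small ?expR0// size_drop size_tuple (eqP (ltnW nj)).
  under eq_bigr do rewrite small.
  rewrite sumr_const card_tuple ler_nat leq_pexp2l// ?card_gt0_of_sum//.
  by rewrite (leq_trans (ltnW nj))// (leq_trans jm)// leq_pmull.
rewrite -(subnKC jn) (sum_tuple_cat j (n - j) (fun i => expR (blocks_ln (drop j i)))).
under eq_bigr => s _ do under eq_bigr do rewrite drop_size_cat ?size_tuple//.
rewrite sumr_const card_tuple -[X in X <= _]mulr_natl mul2n -addnn expnD natrM.
apply: ler_pM; first exact: ler0n.
- by apply: sumr_ge0 => i _; exact: expR_ge0.
- by rewrite ler_nat leq_pexp2l// card_gt0_of_sum.
- exact: sum_expR_blocks_ln.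
Qed.

(** Division by m turns the sum over offsets into a mean, and Jensen's inequality reduces the claim
    to a single offset. That the bound is free of n is the point. *)
Lemma sum_expR_windows_ln n :
  \sum_(i : n.-tuple A) expR (windows_ln i / m%:R) <= (#|A| ^ (2 * m))%:R.
Proof.
have mR : (0 : R) < m%:R by rewrite ltr0n.
apply: (@le_trans _ _ (\sum_(i : n.-tuple A)
    (\sum_(j < m) expR (blocks_ln (drop j i))) / m%:R)).
  by apply: ler_sum => i _; exact: jensen_expR.
rewrite -mulr_suml ler_pdivrMr// exchange_big/=.
apply: (@le_trans _ _ (\sum_(j < m) (#|A| ^ (2 * m))%:R)).
  by apply: ler_sum => j _; apply: sum_expR_blocks_ln_drop; exact: ltnW.
by rewrite sumr_const card_ord mulr_natr.
Qed.

End windows.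

(** * Upper bound *)

Section upper_bound.
Context {R : realType} {N : nat} {X : metricType R}.
Variables (U : weak_probability R N -> X) (U_continuous : continuous U).
Variables (C : set X) (phi : strings N -> R) (phi_continuous : continuous phi).

Definition cylinder_weight n (i : n.-tuple 'I_N.+1) : \bar R :=
  ereal_sup [set (expR (birkhoff_sum phi n u))%:E | u in cylinder i].

Lemma cylinder_weight_ge0 n (i : n.-tuple 'I_N.+1) : (0 <= cylinder_weight i)%E.
Proof.
apply: le_trans (_ : ((expR (birkhoff_sum phi n (pad i)))%:E <= _)%E).
  by rewrite lee_fin expR_ge0.
by apply: ereal_sup_ubound; exists (pad i) => //; exact: cylinder_pad.
Qed.

(** The first condition is that of [partition_function] and bears on the whole cylinder; W is tested
    at a single point, so that localizing to a union splits into two cases. *)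
Definition localized n (r : R) (W : set (weak_probability R N))
    (i : n.-tuple 'I_N.+1) : Prop :=
  [set U (empirical n u) | u in cylinder i] `<=` neighborhood C r /\
  exists2 u, cylinder i u & W (empirical n u).

(* The part of the pressure carried by W grows at rate at most t. *)
Definition small (t : R) (W : set (weak_probability R N)) : Prop :=
  exists2 r, 0 < r & exists K, \forall n \near \oo,
    (\sum_(i : n.-tuple 'I_N.+1 | `[< localized r W i >]) cylinder_weight i <=
     (K * expR (n%:R * t))%:E)%E.

Lemma small_of_none t (W : set (weak_probability R N)) r : 0 < r ->
  (\forall n \near \oo, forall i : n.-tuple 'I_N.+1, ~ localized r W i) ->
  small t W.
Proof.
move=> r0 none; exists r => //; exists 0; apply: filterS none => n none.
rewrite big1 ?mul0r// => i /asboolP; by move/none.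
Qed.

(** An empirical image within e / 2 of both [U mu] and a point of C would put that point within e of
    [U mu], inside a ball disjoint from C. *)
Lemma small_far t (mu : weak_probability R N) : ~ closure C (U mu) ->
  exists2 W, nbhs mu W & small t W.
Proof.
move=> nC; have [B [UB CB]] : exists B, nbhs (U mu) B /\ C `&` B = set0.
  apply: contrapT => nB; apply: nC => B UB; apply/set0P/negP => /eqP CB.
  by apply: nB; exists B.
move/nbhs_ballP : UB => [e /= e0 eB].
have e20 : 0 < e / 2 by rewrite divr_gt0.
exists (U @^-1` ball (U mu) (e / 2)).
  by have := @U_continuous mu _ (nbhsx_ballx (U mu) _ e20).
apply: (@small_of_none _ _ _ e20); near=> n => i [iC [u iu Wu]].
have /neighborhoodP[y Cy uy] := iC (U (empirical n u)) (ex_intro2 _ _ u iu erefl).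
suff : (C `&` B) y by rewrite CB.
split=> //; apply: eB; apply: (@ball_splitr _ _ (U (empirical n u))) => //.
exact: ball_sym.
Unshelve. all: by end_near. Qed.

Lemma birkhoff_sum_shift (f : strings N -> R) n u :
  birkhoff_sum (f \o shift) n u - birkhoff_sum f n u = f (iter n shift u) - f u.
Proof.
elim: n => [|n IH]; first by rewrite /birkhoff_sum !big_ord0 !subrr.
rewrite !birkhoff_sumS /= -[shift (iter n shift u)]/(iter n.+1 shift u).
by have := IH; lra.
Qed.

(** Empirical measures are nearly invariant: for them the integrals of f and of f after the shift
    differ, by telescoping, by at most 1 / n. For mu they differ by a fixed amount, f being the
    indicator of a suitable word. *)
Lemma small_not_invariant t (mu : weak_probability R N) :
  ~ invariant (mu : probability (strings N) R) ->
  exists2 W, nbhs mu W & small t W.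
Proof.
move=> /invariantP/existsNP[q /existsNP[w /eqP ninv]].
pose f (u : strings N) : R := (pref q u == w)%:R.
have f01 u : 0 <= f u <= 1 by rewrite /f; case: (_ == _); rewrite ?lexx ?ler01.
have mZ : discrete_rv (@pref N q) by exact: pref_discrete_rv.
have fc : continuous f.
  apply: modulus_continuous => e e0; exists q => u v /pref_agree uv.
  by rewrite /f uv subrr normr0 ltW.
have fsc : continuous (f \o shift) by exact: (comp_iter_shift_continuous (j := 1)).
have fE (Z : strings N -> q.-tuple 'I_N.+1) : discrete_rv Z ->
    \int[mu]_u (Z u == w)%:R = law mu Z w.
  move=> mZ'; rewrite (Rintegral_law mu (fun w' => (w' == w)%:R) mZ').
  rewrite (bigD1 w)//= eqxx mulr1 big1 ?addr0// => w' /negbTE ->.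
  by rewrite mulr0.
(* The gap for mu is 4 d; closeness on f and on its shift takes 2 d, the telescoped difference d /
   2. *)
pose d := `|law mu (pref q \o shift) w - law mu (pref q) w| / 4.
have d0 : 0 < d by rewrite divr_gt0// normr_gt0 subr_eq0.
exists (close_on f d mu `&` close_on (f \o shift) d mu).
  by apply: filterI; exact: close_on_nbhs.
apply: (@small_of_none _ _ _ ltr01); near=> n => i [_ [u iu []]].
have n0 : (0 < n)%N by near: n; exists 1%N.
have nR : (0 : R) < n%:R by rewrite ltr0n.
rewrite /close_on /= !Rintegral_empirical// => h1 h2.
have nd : 2 <= n%:R * d.
  by rewrite mulrC -ler_pdivrMl//; near: n; exact: nbhs_infty_ger.
have e1 : \int[mu]_u f u = law mu (pref q) w by exact: fE.
have e2 : \int[mu]_u f (shift u) = law mu (pref q \o shift) w.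
  by apply: (fE (pref q \o shift)); exact: (@discrete_rv_iter_shift _ _ _ 1 mZ).
rewrite e1 e2 in h1 h2.
have h3 : `|n%:R^-1 * birkhoff_sum (f \o shift) n u - n%:R^-1 * birkhoff_sum f n u| <= d / 2.
  rewrite -mulrBr birkhoff_sum_shift normrM ger0_norm ?invr_ge0 ?(ltW nR)//.
  rewrite ler_pdivrMl//.
  have := f01 u; have := f01 (iter n shift u); move: nd; rewrite ler_norml; lra.
have : 4 * d = `|law mu (pref q \o shift) w - law mu (pref q) w|.
  by rewrite /d mulrC mulfVK.
move: h1 h2 h3 d0; set a := law _ _ _; set b := law _ _ _.
rewrite !ler_norml => h1 h2 h3 d0.
by case: (ler0P (b - a)); lra.
Unshelve. all: by end_near. Qed.

(** As the logarithms are nonpositive, the windows that stick out of s only lower the left-hand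
    side. *)
Lemma birkhoff_le_windows_ln m (q : seq 'I_N.+1 -> R) (s : seq 'I_N.+1) u :
  (0 < m)%N -> (forall w : m.-tuple 'I_N.+1, ln (q w) <= 0) ->
  (forall j, (j < size s)%N -> u j = nth ord0 s j) ->
  birkhoff_sum (fun v => ln (q (pref m v))) (size s) u <= windows_ln m q s.
Proof.
move=> m0 q0; elim: s u => [|x s IH] u us.
  rewrite windows_ln_small// /birkhoff_sum big_ord0//.
have us' j : (j < size s)%N -> shift u j = nth ord0 s j.
  by move=> js; rewrite /shift us.
have /= IHu := IH _ us'.
rewrite -/(size (x :: s)) -[X in birkhoff_sum _ X _]add1n birkhoff_sumD /=.
rewrite {1}/birkhoff_sum big_ord1/=.
have [ms|sm] := leqP m (size (x :: s)).
  rewrite windows_ln_cons//.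
  suff -> : take m (x :: s) = pref m u :> seq _ by rewrite lerD2l.
  apply: (@eq_from_nth _ ord0) => [|j]; rewrite size_takel ?size_tuple// => jm.
  by rewrite nth_take// -us ?(leq_trans jm)// -[RHS](tnth_nth _ _ (Ordinal jm)) tnth_mktuple.
rewrite windows_ln_small//.
have := q0 (pref m u); rewrite windows_ln_small// in IHu; last exact: ltn_trans sm.
by move: IHu; lra.
Qed.

(** Near mu the weight of a word is at most exp of its [windows_ln] over m, times exp (n t) and a
    constant; [sum_expR_windows_ln] bounds the sum of the first factors uniformly in n. *)
Lemma small_invariant t (mu : weak_probability R N) m :
  (0 < m)%N -> m%:R^-1 * word_entropy mu m + \int[mu]_u phi u < t ->
  exists2 W, nbhs mu W & small t W.
Proof.
move=> m0 Ht; have mR : (0 : R) < m%:R by rewrite ltr0n.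
pose p := word_law mu m; pose L : R := #|{: m.-tuple 'I_N.+1}|%:R.
have L0 : 0 < L by rewrite ltr0n; apply/card_gt0P; exists [tuple of nseq m ord0].
(* The room in the exponent is 4 n e: the modulus of [phi] and closeness on [phi] take one part
   each, the smoothing of q and closeness on [g], both divided by m, at most one part each. *)
pose e := (t - (m%:R^-1 * word_entropy mu m + \int[mu]_u phi u)) / 4.
have e0 : 0 < e by rewrite divr_gt0// subr_gt0.
have e1 : 0 < 1 + e by rewrite ltr_pwDl// ltW.
(* Smoothing the law keeps q positive on the words of measure zero. *)
pose q (s : seq 'I_N.+1) := (p s + e / L) / (1 + e).
have q_gt0 s : 0 < q s.
  by rewrite divr_gt0// ltr_wpDl ?word_law_ge0// divr_gt0.
have q1 : \sum_(w : m.-tuple 'I_N.+1) q w = 1.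
  rewrite /q -mulr_suml big_split/= sum_word_law sumr_const -[_ *+ _]mulr_natr.
  have -> : #|(xpredT : pred (m.-tuple 'I_N.+1))|%:R = L by congr (_%:R); exact: eq_card.
  by rewrite mulfVK ?gt_eqF// divff ?gt_eqF.
have lnq0 (w : m.-tuple 'I_N.+1) : ln (q w) <= 0.
  by rewrite ln_le0// -q1 (bigD1 w)//= lerDl sumr_ge0// => i _; exact: ltW.
pose g (v : strings N) := ln (q (pref m v)).
have gc : continuous g.
  apply: modulus_continuous => d d0; exists m => u v /pref_agree uv.
  by rewrite /g uv subrr normr0 ltW.
(* Compared with - ln p, smoothing adds at most ln (1 + e) <= e. *)
have gE : - (\int[mu]_u g u) <= word_entropy mu m + e.
  rewrite (Rintegral_law mu (fun w : m.-tuple _ => ln (q w))); last exact: pref_discrete_rv.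
  have -> : word_entropy mu m + e =
      \sum_(w : m.-tuple 'I_N.+1) p w * (- ln (p w) + e).
    under eq_bigr do rewrite mulrDr mulrN.
    rewrite big_split/= -mulr_suml sum_word_law mul1r sumrN; congr (- _ + _).
    by apply: eq_bigr => w _; rewrite /p word_lawE.
  rewrite -sumrN; apply: ler_sum => w _; rewrite -word_lawE -/p -mulrN.
  have := word_law_ge0 mu m w; rewrite -/(p w) le_eqVlt => /predU1P[<-|pw].
    by rewrite !mul0r.
  rewrite ler_pM2l// /q lnM ?posrE ?invr_gt0//; last by rewrite addr_gt0// divr_gt0.
  rewrite lnV ?posrE// opprD opprK lerD//.
    have eL : 0 < e / L by rewrite divr_gt0.
    by rewrite lerN2 ler_ln ?posrE ?addr_gt0// lerDl ltW.
  by rewrite le_ln1Dx// (lt_trans _ e0)// ltrN10.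
have [k phik] := uniform_modulus phi_continuous e0.
have [M M0 phiM] := continuous_bounded phi_continuous.
exists (close_on g e mu `&` close_on phi e mu).
  by apply: filterI; exact: close_on_nbhs.
exists 1 => //; pose c := k%:R * (2 * M).
exists ((#|'I_N.+1| ^ (2 * m))%:R * expR c).
near=> n; have n0 : (0 < n)%N by near: n; exists 1%N.
have nR : (0 : R) < n%:R by rewrite ltr0n.
pose D := expR c * expR (n%:R * t).
have weight_le (i : n.-tuple 'I_N.+1) :
    localized 1 (close_on g e mu `&` close_on phi e mu) i ->
    (cylinder_weight i <= (expR (windows_ln m q i / m%:R) * D)%:E)%E.
  move=> [_ [u iu []]]; rewrite /close_on /= !Rintegral_empirical// => hg hphi.
  apply: ge_ereal_sup => _ [v iv <-]; rewrite lee_fin /D -!expRD ler_expR.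
  have uv : agree n v u.
    by apply/pref_agree; move/cylinderP : iu => ->; exact/cylinderP.
  have h1 := birkhoff_sum_agree phik (ltW e0) phiM uv.
  have h2 : birkhoff_sum phi n u <= n%:R * (\int[mu]_v phi v + e).
    by rewrite -ler_pdivrMl//; move: hphi; rewrite ler_norml; lra.
  have h3 : n%:R * (\int[mu]_v g v - e) <= birkhoff_sum g n u.
    by rewrite -ler_pdivlMl//; move: hg; rewrite ler_norml; lra.
  have h4 : birkhoff_sum g n u <= windows_ln m q i.
    rewrite -{1}(size_tuple i); apply: birkhoff_le_windows_ln => // j.
    rewrite size_tuple => jn; rewrite -(tnth_nth _ _ (Ordinal jn)).
    by rewrite -(iu (Ordinal jn)).
  have h5 : n%:R * (- word_entropy mu m - 2 * e) / m%:R <= windows_ln m q i / m%:R.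
    rewrite ler_pM2r ?invr_gt0//; apply: le_trans h4; apply: le_trans h3.
    by rewrite ler_pM2l//; move: gE; lra.
  have h6 : n%:R * (2 * e / m%:R) <= n%:R * (2 * e).
    by rewrite ler_pM2l// ler_pdivrMr// ler_peMr ?ler1n// mulr_ge0// ltW.
  have tE : n%:R * t = n%:R * (\int[mu]_v phi v) +
      n%:R * (m%:R^-1 * word_entropy mu m) + 4 * (n%:R * e).
    by rewrite /e; field; rewrite pnatr_eq0 -lt0n.
  rewrite tE.
  have h7 : n%:R * (- word_entropy mu m - 2 * e) / m%:R =
    - (n%:R * (m%:R^-1 * word_entropy mu m)) - n%:R * (2 * e / m%:R) by ring.
  move: h1; rewrite -/c ler_norml => /andP[_ h1].
  by move: h2 h5 h6; rewrite h7; lra.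
apply: (@le_trans _ _ (\sum_(i : n.-tuple 'I_N.+1)
    (expR (windows_ln m q i / m%:R) * D)%:E)%E).
  rewrite big_mkcond/=; apply: lee_sum => i _; case: asboolP => [/weight_le//|_].
  by rewrite lee_fin mulr_ge0 ?expR_ge0// mulr_ge0 ?expR_ge0.
rewrite sumEFin lee_fin -mulr_suml -mulrA.
rewrite ler_wpM2r ?mulr_ge0 ?expR_ge0//.
exact: sum_expR_windows_ln.
Unshelve. all: by end_near. Qed.

Lemma small_local t (mu : weak_probability R N) :
  (invariant (mu : probability (strings N) R) -> closure C (U mu) ->
    (entropy mu + (\int[mu]_u phi u)%:E < t%:E)%E) ->
  exists2 W, nbhs mu W & small t W.
Proof.
move=> st; have [inv|/small_not_invariant] := pselect (invariant mu); last exact.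
have [CU|/small_far] := pselect (closure C (U mu)); last exact.
have {}st := st inv CU.
(* If no m worked, t minus the integral would be a lower bound for every H_m / m, hence for the
   entropy. *)
have [m [m0 mt]] : exists m, (0 < m)%N /\
    m%:R^-1 * word_entropy mu m + \int[mu]_u phi u < t.
  apply: contrapT => /forallNP nm; move: st; apply/negP; rewrite -leNgt.
  rewrite -leeBlDr// -EFinB; apply: le_entropy => // m m0.
  rewrite lerBlDr leNgt; apply/negP => mt; exact: (nm m).
exact: small_invariant mt.
Qed.

End upper_bound.

(** * Small sets form an ideal *)

Section small_ideal.
Context {R : realType} {N : nat} {X : metricType R}.
Variables (U : weak_probability R N -> X) (C : set X) (phi : strings N -> R).

Lemma neighborhood_le (r r' : R) : r <= r' ->
  neighborhood C r `<=` neighborhood C r'.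
Proof. by move=> rr' x /= xr; apply: lt_le_trans xr _; rewrite lee_fin. Qed.

Lemma sumS_cylinder_weight n (P Q : n.-tuple 'I_N.+1 -> Prop) :
  (forall i, P i -> Q i) ->
  (\sum_(i : n.-tuple 'I_N.+1 | `[< P i >]) cylinder_weight phi i <=
   \sum_(i : n.-tuple 'I_N.+1 | `[< Q i >]) cylinder_weight phi i)%E.
Proof.
move=> PQ; rewrite [leLHS]big_mkcond [leRHS]big_mkcond/=; apply: lee_sum => i _.
case: asboolP => [/PQ Qi|_]; first by rewrite asboolT.
by case: ifP => // _; exact: cylinder_weight_ge0.
Qed.

Lemma sumU_cylinder_weight n (P Q : n.-tuple 'I_N.+1 -> Prop) :
  (\sum_(i : n.-tuple 'I_N.+1 | `[< P i \/ Q i >]) cylinder_weight phi i <=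
   \sum_(i : n.-tuple 'I_N.+1 | `[< P i >]) cylinder_weight phi i +
   \sum_(i : n.-tuple 'I_N.+1 | `[< Q i >]) cylinder_weight phi i)%E.
Proof.
rewrite [leLHS]big_mkcond [X in (_ <= X + _)%E]big_mkcond [X in (_ <= _ + X)%E]big_mkcond/=.
rewrite -big_split/=; apply: lee_sum => i _.
have w0 := cylinder_weight_ge0 phi i.
case: asboolP => [[Pi|Qi]|nPQ].
- by rewrite [in leRHS]asboolT// leeDl//; case: ifP.
- by rewrite [`[< Q i >]]asboolT// leeDr//; case: ifP.
- by rewrite adde_ge0//; case: ifP.
Qed.

Lemma localized_le n (r r' : R) (W W' : set (weak_probability R N))
    (i : n.-tuple 'I_N.+1) : r <= r' -> W `<=` W' ->
  localized U C r W i -> localized U C r' W' i.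
Proof.
move=> rr' WW' [iC [u iu Wu]]; split; last by exists u => //; exact: WW'.
exact: subset_trans iC (neighborhood_le rr').
Qed.

Lemma small_sub t (W W' : set (weak_probability R N)) : W `<=` W' ->
  small U C phi t W' -> small U C phi t W.
Proof.
move=> WW' [r r0 [K Kn]]; exists r => //; exists K; apply: filterS Kn => n.
by apply: le_trans; apply: sumS_cylinder_weight => i; exact: localized_le.
Qed.

Lemma small0 t : small U C phi t set0.
Proof.
by apply: (@small_of_none _ _ _ _ _ _ _ _ _ ltr01); near=> n => i [_ []].
Unshelve. all: by end_near. Qed.

Lemma smallU t (W W' : set (weak_probability R N)) :
  small U C phi t W -> small U C phi t W' -> small U C phi t (W `|` W').
Proof.
move=> [r r0 [K Kn]] [r' r'0 [K' K'n]].
exists (Num.min r r'); first by rewrite lt_min r0.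
exists (K + K'); near=> n.
rewrite mulrDl EFinD; apply: le_trans (_ : (_ <= \sum_(i : n.-tuple 'I_N.+1 |
    `[< localized U C r W i \/ localized U C r' W' i >]) cylinder_weight phi i)%E) _.
  apply: sumS_cylinder_weight => i [iC [u iu [Wu|W'u]]]; [left|right].
    apply: (@localized_le _ (Num.min r r') _ W) => //; last by split=> //; exists u.
    by rewrite ge_min lexx.
  apply: (@localized_le _ (Num.min r r') _ W') => //; last by split=> //; exists u.
  by rewrite ge_min lexx orbT.
apply: le_trans (sumU_cylinder_weight _ _) _; apply: leeD; near: n; [exact: Kn|exact: K'n].
Unshelve. all: by end_near. Qed.

(** Were the whole space not small, the complements of small sets would form a proper filter, with a
    cluster point by compactness; but that point has a small neighbourhood. *)
Lemma small_setT t :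
  (forall mu : weak_probability R N, exists2 W, nbhs mu W & small U C phi t W) ->
  small U C phi t setT.
Proof.
move=> loc; apply: contrapT => nsT.
pose F : set_system (weak_probability R N) := [set W | small U C phi t (~` W)].
have FF : ProperFilter F.
  split; first by rewrite /F/= setC0.
  split; first by rewrite /F /= setCT; exact: small0.
  - by move=> A B FA FB; rewrite /F /= setCI; exact: smallU.
  - by move=> A B AB; rewrite /F/=; apply: small_sub; exact: subsetC.
have [mu [_ Fmu]] := weak_compact FF (@filterT _ F _).
have [W muW sW] := loc mu.
have FW : F (~` W) by rewrite /F /= setCK.
by have [nu [nW]] := Fmu _ _ FW muW.
Qed.

End small_ideal.

(** * From partition functions to pressures *)

Section pressure_bounds.
Context {R : realType} {N : nat} {X : metricType R}.
Variables (U : weak_probability R N -> X) (U_continuous : continuous U).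
Variables (C : set X) (phi : strings N -> R) (phi_continuous : continuous phi).

Lemma EFin_Rintegral (mu : probability (strings N) R) :
  (\int[mu]_u phi u)%:E = (\int[mu]_u (phi u)%:E)%E.
Proof.
by rewrite /Rintegral fineK//; apply: integrable_fin_num => //; exact: continuous_integrable.
Qed.

Lemma partition_function_le (t : R) : (variational_sup U C phi < t%:E)%E ->
  exists2 r0, 0 < r0 & exists2 K, 1 <= K & forall r, r <= r0 -> \forall n \near \oo,
    (partition_function U (neighborhood C r) phi n <= (K * expR (n%:R * t))%:E)%E.
Proof.
move=> st; have [r0 r00 [K Kn]] : small U C phi t setT.
  apply: small_setT => mu; apply: small_local => // inv CU.
  apply: le_lt_trans st; apply: ereal_sup_ubound; exists mu => //.
  by rewrite EFin_Rintegral.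
(* Smallness may hold with [K] equal to 0, while the logarithm of the constant is taken later; hence
   the maximum with 1. *)
exists r0 => //; exists (Num.max K 1); first by rewrite le_max lexx orbT.
move=> r rr0; apply: filterS Kn => n H.
apply: (@le_trans _ _ (K * expR (n%:R * t))%:E); last first.
  by rewrite lee_fin ler_wpM2r ?expR_ge0// le_max lexx.
apply: le_trans H; apply: (@sumS_cylinder_weight _ _ phi n (fun i =>
  [set U (empirical n u) | u in cylinder i] `<=` neighborhood C r)) => i iC.
split; first exact: subset_trans iC (neighborhood_le rr0).
by exists (pad i) => //; exact: cylinder_pad.
Qed.

Lemma partition_function_ge_sup (t : R) : (t%:E < variational_sup U C phi)%E ->
  forall r, 0 < r -> \forall n \near \oo,
    ((expR (n%:R * t))%:E <= partition_function U (neighborhood C r) phi n)%E.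
Proof.
move=> /ereal_sup_gt[_ [mu [inv CU] <-]]; rewrite -EFin_Rintegral => tmu r r0.
have /ereal_sup_gt[_ [k [P [fP ->]]]] : ((t - \int[mu]_u phi u)%:E < entropy mu)%E.
  by rewrite EFinB lteBlDr.
rewrite lte_fin ltrBlDr => tP.
by apply: (partition_function_ge U_continuous phi_continuous inv CU _ tP r0) => m;
  exact: partition_entropy_le_word.
Qed.

Lemma near_limn_esup_le (u : (\bar R)^nat) x :
  (\forall n \near \oo, (u n <= x)%E) -> (limn_esup u <= x)%E.
Proof.
move=> ux; apply: (@le_trans _ _ (ereal_sup (u @` [set n | (u n <= x)%E]))).
  by apply: ereal_inf_lbound; exists [set n | (u n <= x)%E].
by apply: ge_ereal_sup => _ [n un <-].
Qed.

Lemma near_limn_einf_ge (u : (\bar R)^nat) x :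
  (\forall n \near \oo, (x <= u n)%E) -> (x <= limn_einf u)%E.
Proof.
move=> ux; rewrite /limn_einf leeNr; apply: near_limn_esup_le.
by apply: filterS ux => n; rewrite leeN2.
Qed.

(** The gap between t and t' absorbs ln K / n. A partition function equal to 0 has logarithm -oo and
    is treated apart. *)
Lemma log_growth_le (D : set X) (K t t' : R) : 1 <= K -> t < t' ->
  (\forall n \near \oo, (partition_function U D phi n <= (K * expR (n%:R * t))%:E)%E) ->
  (upper_pressure U D phi <= t'%:E)%E.
Proof.
move=> K1 tt' ZK; have K0 : 0 < K := lt_le_trans ltr01 K1.
apply: near_limn_esup_le; near=> n.
have n0 : (0 < n)%N by near: n; exists 1%N.
have nR : (0 : R) < n%:R by rewrite ltr0n.
have : (partition_function U D phi n <= (K * expR (n%:R * t))%:E)%E by near: n.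
rewrite /log_growth; case: (partition_function _ _ _ _) => [z||];
  rewrite /= ?leye_eq//; last first.
  by move=> _; rewrite mulrNy gtr0_sg ?invr_gt0// mul1e leNye.
rewrite lee_fin => zK; case: (leP z 0) => z0.
  by rewrite mulrNy gtr0_sg ?invr_gt0// mul1e leNye.
rewrite -EFinM lee_fin ler_pdivrMl//.
have := zK; rewrite -ler_ln ?posrE ?mulr_gt0 ?expR_gt0// lnM ?posrE ?expR_gt0// expRK.
have : ln K <= n%:R * (t' - t).
  by rewrite [leRHS]mulrC -ler_pdivrMl ?subr_gt0//; near: n; exact: nbhs_infty_ger.
by lra.
Unshelve. all: by end_near. Qed.

Lemma log_growth_ge (D : set X) (t : R) :
  (\forall n \near \oo, ((expR (n%:R * t))%:E <= partition_function U D phi n)%E) ->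
  (t%:E <= lower_pressure U D phi)%E.
Proof.
move=> Zt; apply: near_limn_einf_ge; near=> n.
have n0 : (0 < n)%N by near: n; exists 1%N.
have nR : (0 : R) < n%:R by rewrite ltr0n.
have : ((expR (n%:R * t))%:E <= partition_function U D phi n)%E by near: n.
rewrite /log_growth; case: (partition_function _ _ _ _) => [z||];
  rewrite /= ?leeNy_eq//; last first.
  by move=> _; rewrite mulry gtr0_sg ?invr_gt0// mul1e leey.
rewrite lee_fin => zt; have z0 := lt_le_trans (expR_gt0 _) zt.
rewrite (lt_geF z0) -EFinM lee_fin ler_pdivlMl//.
by rewrite -[leLHS]expRK ler_ln ?posrE ?expR_gt0.
Unshelve. all: by end_near. Qed.

End pressure_bounds.

(** At a finite s the bounds are used at s - e and s + e. Infinite values have to be covered: s is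
    -oo when no invariant measure has its image in the closure of C. *)
Lemma cvg_at_right_ereal (R : realType) (f : R -> \bar R) (s : \bar R) :
  (forall t : R, (t%:E < s)%E -> forall r, 0 < r -> (t%:E <= f r)%E) ->
  (forall t : R, (s < t%:E)%E -> exists2 r0, 0 < r0 & forall r, 0 < r -> r <= r0 ->
    (f r <= t%:E)%E) ->
  f r @[r --> 0^'+] --> s.
Proof.
move=> flo fhi.
have fhi' t : (s < t%:E)%E -> \forall r \near 0^'+, (f r <= t%:E)%E.
  move=> /fhi[r0 r00 fr0]; near=> r; apply: fr0; near: r; first exact: nbhs_right_gt.
  exact: nbhs_right_le.
case: s flo fhi fhi' => [x||] flo fhi fhi'.
- have fge e : 0 < e -> \forall r \near 0^'+, ((x - e)%:E <= f r)%E.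
    move=> e0; near=> r; apply: flo; first by rewrite lte_fin ltrBlDr ltrDl.
    by near: r; exact: nbhs_right_gt.
  have fle e : 0 < e -> \forall r \near 0^'+, (f r <= (x + e)%:E)%E.
    by move=> e0; apply: fhi'; rewrite lte_fin ltrDl.
  apply/fine_cvgP; split.
    near=> r; rewrite fin_numElt; apply/andP; split.
      by apply: (lt_le_trans (ltNyr (x - 1))); near: r; exact: fge.
    by apply: le_lt_trans (ltry (x + 1)); near: r; exact: fle.
  apply/cvgrPdist_le => e e0; near=> r.
  have : ((x - e)%:E <= f r)%E by near: r; exact: fge.
  have : (f r <= (x + e)%:E)%E by near: r; exact: fle.
  rewrite [(fine \o f) r]/=; case: (f r) => //= y; rewrite !lee_fin ler_norml. lra.
- apply/cvgeyPge => A; near=> r; apply: flo; first exact: ltry.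
  by near: r; exact: nbhs_right_gt.
- by apply/cvgeNyPle => A; apply: fhi'; exact: ltNyr.
Unshelve. all: by end_near. Qed.

(** * The zeta-function *)

Section real_power_series.
Context {R : realType}.

Lemma cvg_real_complex (s : nat -> R) : cvgn s ->
  cvgn ((fun n => (s n)%:C%C) : nat -> (R[i] : numFieldType)).
Proof.
move=> /cvg_ex[l sl]; apply/cvg_ex; exists (l%:C)%C.
apply/cvgrPdist_lt => -[e e'] /=; rewrite ltcE /= => /andP[/eqP e'0 e0].
move/cvgrPdist_lt : sl => /(_ e e0); apply: filterS => n sn.
by rewrite -rmorphB normc_def /= expr0n addr0 sqrtr_sqr ltcE/= e'0 eqxx.
Qed.

Lemma norm_real_complex (x : R) : `|x%:C%C : R[i]| = (`|x|)%:C%C.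
Proof. by rewrite normc_def /= expr0n addr0 sqrtr_sqr. Qed.

Lemma cvg_power_series_real (b : nat -> R) (x : R) :
  cvgn (series (fun n => b n * x ^+ n)) ->
  cvgn (power_series ((fun n => (b n)%:C%C) : nat -> (R[i] : numFieldType)) (x%:C)%C).
Proof.
move=> /cvg_real_complex.
rewrite (_ : power_series _ _ =
  (fun n => (series (fun n => b n * x ^+ n) n)%:C%C))//; apply/funext => n.
rewrite /power_series /series /= rmorph_sum.
by apply: eq_bigr => k _; rewrite rmorphM rmorphXn.
Qed.

Lemma cvg_series_dominated (b : nat -> R) (x K rho : R) :
  (forall n, 0 <= b n) -> 0 <= x -> 0 <= K -> 0 <= rho < 1 ->
  (\forall n \near \oo, b n * x ^+ n <= K * rho ^+ n) ->
  cvgn (series (fun n => b n * x ^+ n)).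
Proof.
move=> b0 x0 K0 /andP[rho0 rho1] [n0 _ n0P].
pose u n := if (n < n0)%N then 0 else b n * x ^+ n.
have : cvgn (series u).
  apply: (@series_le_cvg _ _ (geometric K rho)).
  - by move=> n; rewrite /u; case: ifP => // _; rewrite mulr_ge0// exprn_ge0.
  - by move=> n; rewrite /geometric/= mulr_ge0// exprn_ge0.
  - move=> n; rewrite /u /geometric/=; case: ltnP => [_|]; last exact: n0P.
    by rewrite mulr_ge0// exprn_ge0.
  - by apply: is_cvg_geometric_series; rewrite ger0_norm.
rewrite -(is_cvg_series_restrict n0) -[X in _ -> X](is_cvg_series_restrict n0).
rewrite (_ : (fun n => \sum_(n0 <= k < n) u k) =
  (fun n => \sum_(n0 <= k < n) b k * x ^+ k))//.
apply/funext => n; rewrite big_nat_cond [RHS]big_nat_cond.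
by apply: eq_bigr => k /andP[/andP[nk _] _]; rewrite /u ltnNge nk.
Qed.

(** The quadratic term of exp is already at least n. This lets exponential growth beat the factor 1
    / n of the zeta coefficients. *)
Lemma lt_natr_expR (l : R) (n : nat) : 0 < l -> 2 / l ^+ 2 <= n%:R ->
  n%:R < expR (n%:R * l).
Proof.
move=> l0 ln; have l20 : 0 < l ^+ 2 by rewrite exprn_gt0.
have := @expR_ge1Dxn R (n%:R * l) 1 (mulr_ge0 (ler0n _ n) (ltW l0)).
rewrite (_ : 2`!%:R = 2)//; apply: lt_le_trans.
have : n%:R <= (n%:R * l) ^+ 2 / 2.
  rewrite exprMn ler_pdivlMr// expr2 -mulrA ler_wpM2l//.
  by rewrite -ler_pdivrMr.
by lra.
Qed.

End real_power_series.

Section zeta.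
Context {R : realType} {N : nat} {X : metricType R}.
Variables (U : weak_probability R N -> X).
Variables (phi : strings N -> R) (phi_continuous : continuous phi).
Variable D : set X.

Let Z n := fine (partition_function U D phi n).

Lemma partition_function_fin n :
  partition_function U D phi n \is a fin_num /\ 0 <= Z n.
Proof.
have [M _ phiM] := continuous_bounded phi_continuous.
have w0 : (0 <= partition_function U D phi n)%E.
  by apply: sume_ge0 => i _; exact: (cylinder_weight_ge0 phi i).
split; last exact: fine_ge0.
rewrite ge0_fin_numE//; apply: (@le_lt_trans _ _
  (\sum_(i : n.-tuple 'I_N.+1) (expR (n%:R * M))%:E)%E); last by rewrite sumEFin ltry.
rewrite /partition_function big_mkcond/=; apply: lee_sum => i _.
case: ifP => _; last by rewrite lee_fin expR_ge0.
apply: ge_ereal_sup => _ [u _ <-]; rewrite lee_fin ler_expR.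
exact: le_trans (ler_norm _) (birkhoff_sum_le n u phiM).
Qed.

Let ZE n : partition_function U D phi n = (Z n)%:E.
Proof. by rewrite fineK//; have [] := partition_function_fin n. Qed.

Let Z_ge0 n : 0 <= Z n. Proof. by have [] := partition_function_fin n. Qed.

Let b n : R := if n is 0 then 0 else Z n / n%:R.

Let b_ge0 n : 0 <= b n.
Proof. by case: n => [|n]; rewrite /b// divr_ge0. Qed.

Let zeta_coefE : zeta_coef U D phi = (fun n => (b n)%:C%C).
Proof. by apply/funext => -[|n]. Qed.

(** The series converges at the real point exp (- t'): its terms are eventually dominated by a
    geometric sequence of ratio exp (t - t'), the factor 1 / n being at most 1. *)
Lemma zeta_radius_ge (K t t' : R) : 0 <= K -> t < t' ->
  (\forall n \near \oo, (partition_function U D phi n <= (K * expR (n%:R * t))%:E)%E) ->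
  (- lne (zeta_radius U D phi) <= t'%:E)%E.
Proof.
move=> K0 tt' ZK; pose x := expR (- t'); have x0 : 0 < x := expR_gt0 _.
have xr : (x%:E <= zeta_radius U D phi)%E.
  apply: ereal_sup_ubound; exists (x%:C)%C; last first.
    by rewrite norm_real_complex /= ger0_norm// ltW.
  rewrite /= zeta_coefE; apply: cvg_power_series_real.
  have r01 : 0 <= expR (t - t') < 1 by rewrite expR_ge0 expR_lt1 subr_lt0.
  apply: (cvg_series_dominated b_ge0 (ltW x0) K0 r01).
  near=> n; have n0 : (0 < n)%N by near: n; exists 1%N.
  have : (partition_function U D phi n <= (K * expR (n%:R * t))%:E)%E by near: n.
  rewrite ZE lee_fin => Zn.
  rewrite -!expRM_natl mulrBr expRD mulrA mulrN ler_pM2r ?expR_gt0//.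
  apply: le_trans Zn; rewrite /b; case: (n) n0 => // k _.
  by rewrite ler_pdivrMr// ler_peMr// ler1n.
rewrite leeNl; move: xr; case: (zeta_radius _ _ _) => [r||];
  rewrite /= ?leey ?leeNy_eq// lee_fin => xr.
rewrite (lt_geF (lt_le_trans x0 xr)) lee_fin.
by rewrite -[leLHS]expRK ler_ln ?posrE// (lt_le_trans x0).
Unshelve. all: by end_near. Qed.

(** Convergence at z with |z| > exp (- t) would make the terms eventually smaller than 1, whereas
    their modulus is at least exp (n (ln |z| + t)) / n, which exceeds 1 for large n. *)
Lemma zeta_radius_le (t : R) :
  (\forall n \near \oo, ((expR (n%:R * t))%:E <= partition_function U D phi n)%E) ->
  (t%:E <= - lne (zeta_radius U D phi))%E.
Proof.
move=> Zt.
have rx : (zeta_radius U D phi <= (expR (- t))%:E)%E.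
  apply: ge_ereal_sup => _ [z /= zcvg <-]; rewrite lee_fin leNgt; apply/negP.
  set y := (X in _ < X) => ty; have zy : `|z| = (y%:C)%C by [].
  have y0 : 0 < y := lt_trans (expR_gt0 _) ty.
  have l0 : 0 < ln y + t by rewrite -ltrBlDr sub0r -[ltLHS]expRK ltr_ln ?posrE ?expR_gt0.
  have := @cvg_series_cvg_0 (R[i] : numFieldType) (R[i] : numFieldType)
    (fun n => zeta_coef U D phi n * z ^+ n) zcvg.
  move/cvgr0Pnorm_lt => /(_ 1 ltr01) small.
  have [n [n0 [h1 [h2 h3]]]] : exists n, (0 < n)%N /\
     ((expR (n%:R * t))%:E <= partition_function U D phi n)%E /\
     `|zeta_coef U D phi n * z ^+ n| < 1 /\ 2 / (ln y + t) ^+ 2 <= n%:R.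
    apply: (@filter_ex _ \oo); near=> n; split; first by near: n; exists 1%N.
    split; first by near: n.
    split; first by near: n.
    by near: n; exact: nbhs_infty_ger.
  have nR : (0 : R) < n%:R by rewrite ltr0n.
  move: h2; rewrite zeta_coefE normrM normrX zy norm_real_complex ger0_norm//.
  rewrite -rmorphXn -rmorphM -[1]/((1 : R)%:C)%C ltcR.
  rewrite /b; case: (n) n0 h1 h3 nR => // k _; rewrite ZE lee_fin => h1 h3 nR.
  apply/negP; rewrite -leNgt mulrAC ler_pdivlMr// mul1r.
  apply: le_trans (ltW (lt_natr_expR l0 h3)) _.
  by rewrite mulrDr expRD mulrC [expR (_ * ln _)]expRM_natl lnK// ler_pM2r ?exprn_gt0.
rewrite leeNr; move: rx; case: (zeta_radius _ _ _) => [r||];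
  rewrite /= ?leNye ?leye_eq// lee_fin => rx.
case: ifPn => [_|]; first by rewrite leNye.
rewrite -ltNge => r0; rewrite lee_fin.
by rewrite -[leRHS]expRK ler_ln ?posrE ?expR_gt0.
Unshelve. all: by end_near. Qed.

End zeta.

Lemma lt_EFin_dense (R : realType) (s : \bar R) (t : R) : (s < t%:E)%E ->
  exists2 t', t' < t & (s < t'%:E)%E.
Proof.
case: s => [x|//|]; last first.
  by exists (t - 1); [rewrite ltrBlDr ltrDl|rewrite ltNyr].
by rewrite lte_fin => xt; exists ((x + t) / 2); rewrite ?lte_fin; lra.
Qed.

Theorem theorem5p3 (R : realType) (N : nat) (X : metricType R)
    (U : weak_probability R N -> X) (U_continuous : continuous U)
    (C : set X) (phi : strings N -> R) (phi_continuous : continuous phi) :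
  ((lower_pressure U (neighborhood C r) phi @[r --> 0^'+]
      --> variational_sup U C phi) /\
   (upper_pressure U (neighborhood C r) phi @[r --> 0^'+]
      --> variational_sup U C phi)) /\
  ((- lne (zeta_radius U (neighborhood C r) phi))%E @[r --> 0^'+]
      --> variational_sup U C phi).
Proof.
have lo t : (t%:E < variational_sup U C phi)%E -> forall r, 0 < r ->
    (t%:E <= lower_pressure U (neighborhood C r) phi)%E.
  by move=> ts r r0; apply: log_growth_ge; exact: partition_function_ge_sup.
have lower_upper D : (lower_pressure U D phi <= upper_pressure U D phi)%E.
  exact: limn_einf_sup.
have hi t : (variational_sup U C phi < t%:E)%E -> exists2 r0, 0 < r0 &
    forall r, 0 < r -> r <= r0 -> (upper_pressure U (neighborhood C r) phi <= t%:E)%E.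
  (* The intermediate t' leaves room for the constant factor [K]. *)
  move=> /lt_EFin_dense[t' t't].
  move=> /(partition_function_le U_continuous phi_continuous)[r0 r00 [K K1 ZK]].
  by exists r0 => // r _ rr0; apply: log_growth_le K1 t't _; exact: ZK.
split; [split|]; apply: cvg_at_right_ereal => t.
- exact: lo.
- move=> /hi[r0 r00 H]; exists r0 => // r r1 r2.
  exact: le_trans (lower_upper _) (H r r1 r2).
- by move=> /lo H r r0; exact: le_trans (H r r0) (lower_upper _).
- exact: hi.
- move=> ts r r0; apply: zeta_radius_le => //.
  exact: partition_function_ge_sup.
- move=> /lt_EFin_dense[t' t't].
  move=> /(partition_function_le U_continuous phi_continuous)[r0 r00 [K K1 ZK]].
  exists r0 => // r _ rr0; apply: (@zeta_radius_ge _ _ _ _ _ _ _ K t') => //.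
    exact: le_trans ler01 K1.
  exact: ZK.
Qed.
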